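(* Let $E:\mathcal{H}\to\mathbb{R}$ be of class $C^2$, and let $P_*\in\mathcal{M}_N$ be a nondegenerate local minimizer of $E$ on $\mathcal{M}_N$, in the sense that there exists $\eta>0$ such that $E(P)\ge E(P_* )+\eta\|P-P_*\|_{\rm F}^2$ for all $P\in\mathcal{M}_N$ in a neighborhood of $P_*$. Let $R:\mathcal{H}\to\mathcal{H}$ be of class $C^2$ such that for all $P\in\mathcal{M}_N$ and all $X\in\mathcal{H}$ small enough, $R(P+X)\in\mathcal{M}_N$ and $R(P+X)=P+\Pi_P(X)+O(X^2)$. Then for $\beta>0$ small enough and $P^0\in\mathcal{M}_N$ close enough to $P_*$, the iterates \[ P^{k+1}:=R\big(P^k-\beta\,\Pi_{P^k}(\nabla E(P^k))\big) \] converge linearly to $P_*$ with asymptotic rate $r(1-\beta J_{\rm grad})<1$, where $J_{\rm grad}:=\Omega_*+K_*$; that is, for every $\theta>0$ there is $C_\theta>0$ such that $\|P^k-P_*\|_{\rm F}\le C_\theta\,(r(1-\beta J_{\rm grad})+\theta)^k\,\|P^0-P_*\|_{\rm F}$ for all $k$, for all such $P^0$.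
   Context: $\mathcal{H}$ is the space of real symmetric $N_b\times N_b$ matrices with the Frobenius inner product $\langle A,B\rangle_{\rm F}=\mathrm{Tr}(AB)$. For $1\le N\le N_b$, $\mathcal{M}_N:=\{P\in\mathcal{H}\mid P^2=P,\ \mathrm{Tr}(P)=N\}$. For $P\in\mathcal{M}_N$, $\Pi_P(X)=PX(1-P)+(1-P)XP$ is the orthogonal projection of $\mathcal{H}$ onto the tangent space $T_P\mathcal{M}_N=\{X\in\mathcal{H}\mid PXP=(1-P)X(1-P)=0\}$. Set $H_*:=\nabla E(P_* )$ and $K_*:=\Pi_{P_*}\nabla^2E(P_* )\Pi_{P_*}$, and define $\Omega_*:T_{P_*}\mathcal{M}_N\to T_{P_*}\mathcal{M}_N$ by $\Omega_*X:=P_*X(1-P_* )H_*-H_*P_*X(1-P_* )+\big(P_*X(1-P_* )H_*-H_*P_*X(1-P_* )\big)^{*}$ (equivalently $\Omega_*X=-[P_*,[H_*,X]]$). $J_{\rm grad}=\Omega_*+K_*$ is regarded as an operator on $T_{P_*}\mathcal{M}_N$, and $r(\cdot)$ denotes the spectral radius of an operator on $T_{P_*}\mathcal{M}_N$. *)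

(* Defs.v *)
From HB Require Import structures.
From mathcomp Require Import all_boot all_order all_algebra.
From mathcomp Require Import all_classical all_reals all_analysis.
Set Implicit Arguments. Unset Strict Implicit. Unset Printing Implicit Defensive.
Import Order.TTheory GRing.Theory Num.Theory.
Import numFieldNormedType.Exports.
Local Open Scope classical_set_scope.
Local Open Scope ring_scope.

Definition symz {R : realType} {n : nat} (A : 'M[R]_n) : 'M[R]_n :=
  2^-1 *: (A + A^T).

Definition MN {R : realType} {n : nat} (N : nat) (P : 'M[R]_n) : Prop :=
  P^T = P /\ P *m P = P /\ \tr P = N%:R.

Definition frob {R : realType} {n : nat} (A : 'M[R]_n) : R :=
  Num.sqrt (\sum_i \sum_j A i j ^+ 2).

Definition ProjT {R : realType} {n : nat} (P X : 'M[R]_n) : 'M[R]_n :=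
  P *m X *m (1%:M - P) + (1%:M - P) *m X *m P.

Definition tangent {R : realType} {n : nat} (P X : 'M[R]_n) : Prop :=
  X^T = X /\ P *m X *m P = 0 /\ (1%:M - P) *m X *m (1%:M - P) = 0.

Definition C2 {R : realType} {n : nat} {V : normedModType R}
  (f : 'M[R]_n -> V) : Prop :=
  (forall x u, derivable f x u) /\
  (forall x u v, derivable ('D_u f) x v) /\
  (forall u v, continuous ('D_v ('D_u f))).

(* Frobenius gradient of E restricted to H (E is only used on H, through
   E \o symz): the unique symmetric G with DE(P)[X] = Tr(G X). *)
Definition gradE {R : realType} {n : nat} (E : 'M[R]_n -> R) (P : 'M[R]_n)
  : 'M[R]_n :=
  \matrix_(i, j) derive (E \o symz) P (delta_mx j i).

Definition hessE {R : realType} {n : nat} (E : 'M[R]_n -> R) (P X : 'M[R]_n)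
  : 'M[R]_n :=
  derive (gradE E) P X.

Definition OmegaOp {R : realType} {n : nat} (P H X : 'M[R]_n) : 'M[R]_n :=
  let C := H *m X - X *m H in - (P *m C - C *m P).

Definition Jgrad {R : realType} {n : nat} (E : 'M[R]_n -> R) (Ps X : 'M[R]_n)
  : 'M[R]_n :=
  OmegaOp Ps (gradE E Ps) X + ProjT Ps (hessE E Ps (ProjT Ps X)).

(* spectral radius of a real linear operator L on the subspace T:
   sup of |lambda| over complex eigenvalues lambda = a + i b, i.e. over
   eigenvectors X + iY (X, Y in T, not both 0) of the complexification:
   L X = a X - b Y, L Y = b X + a Y. *)
Definition specrad {R : realType} {n : nat} (T : 'M[R]_n -> Prop)
  (L : 'M[R]_n -> 'M[R]_n) : R :=
  sup [set rho : R | exists (a b : R) (X Y : 'M[R]_n),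
        [/\ T X, T Y, X != 0 \/ Y != 0,
            L X = a *: X - b *: Y /\ L Y = b *: X + a *: Y &
            rho = Num.sqrt (a ^+ 2 + b ^+ 2)]].

Definition gd_iter {R : realType} {n : nat} (E : 'M[R]_n -> R)
  (Rt : 'M[R]_n -> 'M[R]_n) (beta : R) (P0 : 'M[R]_n) (k : nat) : 'M[R]_n :=
  iter k (fun P => Rt (P - beta *: ProjT P (gradE E P))) P0.

(* Main.v *)
(* Write [D = P - Ps] for [P] in [M_N], [Pi] for the projection onto the tangent space [T] at
   [Ps], and [L = 1 - beta J_grad]. The relation [P ^ 2 = P] gives [D = Pi D + O(D ^ 2)], and
   since [Pi (grad E Ps) = 0] the iteration maps [Ps + D] to [Ps + L (Pi D) + o(D)]; only the
   expansion of the retraction at [Ps] itself enters. By Schwarz's theorem [J_grad] is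
   self-adjoint, so the operator norm of [L] on [T] is its spectral radius [r], and the
   iteration contracts by [r + theta] near [Ps] without passing to powers of [L]. Expanding
   [E] to second order along [M_N], whose curvature produces [Omega], the quadratic growth at
   [Ps] makes [J_grad] coercive on [T], whence [r < 1] for small [beta]. *)

(* At the minimizer only the tangent part of the gradient [G] vanishes, so the linear term [<G, D>]
   of the energy survives on the feasible set, as a term of second order. For feasible [D] with
   tangent part [X] it equals [<G, X ^ 2 - 2 P X ^ 2 P>] up to [O(D ^ 3)], which is half of
   [<Omega X, X>]. The same [Omega] is the derivative of the tangent projection of the fixed matrix
   [G] with respect to the base point. Hence the second variation of the energy and the
   linearization of the projected gradient are one operator, and minimality controls the step.
   Growth is known at feasible points only; the retraction supplies such points in every tangent
   direction. The energy matters on symmetric matrices only, while derivatives are taken along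
   arbitrary ones; working with [E \o symz] makes gradients and Hessians symmetric. *)
Require Import Defs.
From HB Require Import structures.
From mathcomp Require Import all_boot all_order all_algebra.
From mathcomp Require Import all_classical all_reals all_analysis.
From mathcomp Require Import ring lra.
Set Implicit Arguments. Unset Strict Implicit. Unset Printing Implicit Defensive.
Import Order.TTheory GRing.Theory Num.Theory.
Import numFieldNormedType.Exports.
Local Open Scope ring_scope.

(** * Frobenius inner product *)

Section Frobenius.
Variables (R : realType) (n : nat).
Implicit Types (A B C X Y P : 'M[R]_n) (a : R).

(** Lagrange's identity: the double sum of [(f i * g j - f j * g i) ^+ 2] is twice the gap between
    the two sides. *)
Lemma sum_cauchy_schwarz (I : finType) (f g : I -> R) :
  (\sum_i f i * g i) ^+ 2 <= (\sum_i f i ^+ 2) * (\sum_i g i ^+ 2).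
Proof.
have H : 0 <= \sum_i \sum_j (f i * g j - f j * g i) ^+ 2.
  by apply: sumr_ge0 => i _; apply: sumr_ge0 => j _; apply: sqr_ge0.
have E : \sum_i \sum_j (f i * g j - f j * g i) ^+ 2 =
   2 * ((\sum_i f i ^+ 2) * (\sum_i g i ^+ 2)) - 2 * (\sum_i f i * g i) ^+ 2.
  rewrite expr2 !mulr_suml !mulr_sumr -sumrB.
  transitivity (\sum_i \sum_j (f i ^+ 2 * g j ^+ 2 + f j ^+ 2 * g i ^+ 2
                  - 2 * (f i * g i * (f j * g j)))).
    by apply: eq_bigr => i _; apply: eq_bigr => j _; ring.
  have -> : \sum_i \sum_j (f i ^+ 2 * g j ^+ 2 + f j ^+ 2 * g i ^+ 2
                  - 2 * (f i * g i * (f j * g j))) =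
    \sum_i \sum_j (f i ^+ 2 * g j ^+ 2) + \sum_i \sum_j (f j ^+ 2 * g i ^+ 2)
    - \sum_i \sum_j (2 * (f i * g i * (f j * g j))).
    rewrite -big_split -sumrB /=; apply: eq_bigr => i _.
    by rewrite -big_split -sumrB.
  rewrite [X in _ + X - _]exchange_big /= -mulr2n -sumrMnl -sumrB.
  apply: eq_bigr => i _.
  by rewrite !mulr_sumr -sumrMnl -sumrB -[RHS]sumrB; apply: eq_bigr => j _; ring.
lra.
Qed.

(** The transpose makes this an inner product on all square matrices, so that nonsymmetric products
    can be paired as well. *)
Definition ip A B : R := \tr (A^T *m B).

Lemma ipE A B : ip A B = \sum_i \sum_j A i j * B i j.
Proof.
rewrite /ip /mxtrace exchange_big; apply: eq_bigr => i _ /=.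
by rewrite mxE; apply: eq_bigr => j _; rewrite mxE.
Qed.

Lemma ipC A B : ip A B = ip B A.
Proof. by rewrite !ipE; apply: eq_bigr => i _; apply: eq_bigr => j _; rewrite mulrC. Qed.
Lemma ipDr A B C : ip A (B + C) = ip A B + ip A C.
Proof. by rewrite /ip mulmxDr mxtraceD. Qed.
Lemma ipZr A a B : ip A (a *: B) = a * ip A B.
Proof. by rewrite /ip -scalemxAr mxtraceZ. Qed.
Lemma ipNr A B : ip A (- B) = - ip A B.
Proof. by rewrite -scaleN1r ipZr mulN1r. Qed.
Lemma ipBr A B C : ip A (B - C) = ip A B - ip A C.
Proof. by rewrite ipDr ipNr. Qed.
Lemma ipDl A B C : ip (A + B) C = ip A C + ip B C.
Proof. by rewrite ipC ipDr !(ipC C). Qed.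
Lemma ipZl a A B : ip (a *: A) B = a * ip A B.
Proof. by rewrite ipC ipZr (ipC B). Qed.
Lemma ipNl A B : ip (- A) B = - ip A B.
Proof. by rewrite ipC ipNr (ipC B). Qed.
Lemma ipBl A B C : ip (A - B) C = ip A C - ip B C.
Proof. by rewrite ipDl ipNl. Qed.
Lemma ip0r A : ip A 0 = 0.
Proof. by rewrite /ip mulmx0 mxtrace0. Qed.
Lemma ip0l A : ip 0 A = 0.
Proof. by rewrite ipC ip0r. Qed.
Definition ip_lin := (ipDr, ipDl, ipBr, ipBl, ipNr, ipNl, ipZr, ipZl, ip0r, ip0l).

Lemma ipMl A B C : ip (A *m B) C = ip B (A^T *m C).
Proof. by rewrite /ip trmx_mul mulmxA. Qed.
Lemma ipMr A B C : ip (A *m B) C = ip A (C *m B^T).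
Proof. by rewrite /ip trmx_mul -mulmxA mxtrace_mulC mulmxA. Qed.

Lemma frob_sqr A : frob A ^+ 2 = ip A A.
Proof.
rewrite /frob sqr_sqrtr ?ipE //; first by apply: sumr_ge0 => i _; apply: sumr_ge0 => j _; exact: sqr_ge0.
Qed.
Lemma frob_ge0 A : 0 <= frob A. Proof. exact: sqrtr_ge0. Qed.
Lemma ip_ge0 A : 0 <= ip A A. Proof. by rewrite -frob_sqr sqr_ge0. Qed.
Lemma frobE A : frob A = Num.sqrt (ip A A).
Proof. by rewrite -frob_sqr sqrtr_sqr ger0_norm ?frob_ge0. Qed.

Lemma frob_entry A i j : `|A i j| <= frob A.
Proof.
rewrite -(@ler_pXn2r _ 2) ?nnegrE ?frob_ge0 // frob_sqr ipE.
rewrite (bigD1 i) //= (bigD1 j) //= real_normK ?num_real // -expr2 -addrA lerDl.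
apply: addr_ge0; first by apply: sumr_ge0 => k _; rewrite -expr2 sqr_ge0.
by apply: sumr_ge0 => k _; apply: sumr_ge0 => l _; rewrite -expr2 sqr_ge0.
Qed.

Lemma frob_eq0 A : frob A = 0 -> A = 0.
Proof.
move=> A0; apply/matrixP => i j; rewrite mxE; apply/normr0_eq0/le_anti.
by rewrite normr_ge0 andbT -A0 frob_entry.
Qed.

Lemma frob0 : frob (0 : 'M[R]_n) = 0.
Proof. by rewrite frobE ip0r sqrtr0. Qed.

Lemma frobZ a A : frob (a *: A) = `|a| * frob A.
Proof. by rewrite !frobE !ip_lin mulrA -expr2 sqrtrM ?sqr_ge0 // sqrtr_sqr. Qed.
Lemma frobN A : frob (- A) = frob A.
Proof. by rewrite -scaleN1r frobZ normrN1 mul1r. Qed.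
Lemma frobC A B : frob (A - B) = frob (B - A).
Proof. by rewrite -opprB frobN. Qed.

Lemma ip_cauchy_schwarz A B : `|ip A B| <= frob A * frob B.
Proof.
rewrite -(@ler_pXn2r _ 2) ?nnegrE ?mulr_ge0 ?frob_ge0 //.
rewrite exprMn !frob_sqr real_normK ?num_real // !ipE !pair_bigA /=.
exact: (sum_cauchy_schwarz (I := 'I_n * 'I_n)%type (fun p => A p.1 p.2) (fun p => B p.1 p.2)).
Qed.

Lemma frobD A B : frob (A + B) <= frob A + frob B.
Proof.
rewrite -(@ler_pXn2r _ 2) ?nnegrE ?addr_ge0 ?frob_ge0 //.
rewrite sqrrD !frob_sqr !ip_lin (ipC B A).
have := ip_cauchy_schwarz A B; have := ler_norm (ip A B).
rewrite mulr2n; lra.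
Qed.
Lemma frobM A B : frob (A *m B) <= frob A * frob B.
Proof.
rewrite -(@ler_pXn2r _ 2) ?nnegrE ?mulr_ge0 ?frob_ge0 //.
rewrite exprMn !frob_sqr !ipE [X in _ * X]exchange_big /= mulr_suml.
apply: ler_sum => i _; rewrite mulr_sumr; apply: ler_sum => j _.
rewrite mxE -expr2; exact: sum_cauchy_schwarz.
Qed.

(** Continuity and derivatives refer to the maximum norm on matrices; this bound and the next carry
    estimates to the Frobenius norm and back. *)
Lemma mxnorm_frob A : `|A| <= frob A.
Proof.
rewrite [leLHS]mx_normrE; apply: bigmax_le; first exact: frob_ge0.
by move=> [i j] _; exact: frob_entry.
Qed.

Lemma frob_mxnorm A : frob A <= n%:R * `|A|.
Proof.
rewrite -(@ler_pXn2r _ 2) ?nnegrE ?mulr_ge0 ?frob_ge0 // frob_sqr ipE exprMn.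
apply: (@le_trans _ _ (\sum_(i < n) \sum_(j < n) `|A| ^+ 2)).
  apply: ler_sum => i _; apply: ler_sum => j _.
  rewrite -expr2 -real_normK ?num_real // ler_pXn2r ?nnegrE // [leRHS]mx_normrE.
  exact: (le_bigmax _ (fun p : 'I_n * 'I_n => `|A p.1 p.2|) (i, j)).
by rewrite !sumr_const !card_ord -mulrnA mulnn -[leLHS]mulr_natl natrX.
Qed.

End Frobenius.

(** * Tangent projection *)

Lemma addmxE (R : nmodType) m n (A B : 'M[R]_(m, n)) i j : (A + B) i j = A i j + B i j.
Proof. by rewrite mxE. Qed.
Lemma oppmxE (R : zmodType) m n (A : 'M[R]_(m, n)) i j : (- A) i j = - A i j.
Proof. by rewrite mxE. Qed.
Lemma scalemxE (R : nzRingType) m n (a : R) (A : 'M[R]_(m, n)) i j : (a *: A) i j = a * A i j.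
Proof. by rewrite mxE. Qed.
Lemma zeromxE (R : nmodType) m n i j : (0 : 'M[R]_(m, n)) i j = 0.
Proof. by rewrite mxE. Qed.

Lemma mulmxZl (R : pzSemiRingType) m n p (a : R) (A : 'M[R]_(m, n)) (B : 'M[R]_(n, p)) :
  (a *: A) *m B = a *: (A *m B).
Proof. by rewrite scalemxAl. Qed.
Lemma mulmxZr (R : comPzSemiRingType) m n p (a : R) (A : 'M[R]_(m, n)) (B : 'M[R]_(n, p)) :
  A *m (a *: B) = a *: (A *m B).
Proof. by rewrite scalemxAr. Qed.

(* Distributes products completely, so that what remains to be checked is an
   identity in an abelian group, settled entrywise by [ring]. *)
Ltac mx_expand := rewrite ?(mulmxDl, mulmxDr, mulmxBl, mulmxBr, mulmxN, mulNmx,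
  mulmxZl, mulmxZr, mul1mx, mulmx1, mul0mx, mulmx0, mulmxA).
Ltac mx_close := let i := fresh in let j := fresh in
  apply/matrixP => i j; rewrite ?(addmxE, oppmxE, scalemxE, zeromxE); ring.

Section TangentProjection.
Variables (R : realType) (n : nat) (P : 'M[R]_n).
Implicit Types (A B X Y H : 'M[R]_n) (a : R).
Hypotheses (PT : P^T = P) (PP : P *m P = P).

Let idem X : X *m P *m P = X *m P. Proof. by rewrite -mulmxA PP. Qed.

Lemma ProjTE X : ProjT P X = P *m X + X *m P - 2 *: (P *m X *m P).
Proof. by rewrite /ProjT; mx_expand; mx_close. Qed.

Lemma ProjTD X Y : ProjT P (X + Y) = ProjT P X + ProjT P Y.
Proof. by rewrite !ProjTE; mx_expand; mx_close. Qed.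
Lemma ProjTZ a X : ProjT P (a *: X) = a *: ProjT P X.
Proof. by rewrite !ProjTE; mx_expand; mx_close. Qed.
Lemma ProjTN X : ProjT P (- X) = - ProjT P X.
Proof. by rewrite -(scaleN1r X) ProjTZ scaleN1r. Qed.
Lemma ProjTB X Y : ProjT P (X - Y) = ProjT P X - ProjT P Y.
Proof. by rewrite ProjTD ProjTN. Qed.

Lemma trmx_ProjT X : (ProjT P X)^T = ProjT P X^T.
Proof.
by rewrite !ProjTE linearB /= linearZ /= linearD /= !trmx_mul PT; mx_expand; mx_close.
Qed.

Lemma ip_ProjT X Y : ip (ProjT P X) Y = ip X (ProjT P Y).
Proof. by rewrite !ProjTE !ip_lin (ipMr (P *m X) P) (ipMr X P) !(ipMl P X) PT ?mulmxA. Qed.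

Lemma ProjT_idem X : ProjT P (ProjT P X) = ProjT P X.
Proof.
by rewrite !ProjTE; mx_expand; rewrite !(idem, PP); mx_close.
Qed.

Lemma tangentP X : tangent P X <-> X^T = X /\ ProjT P X = X.
Proof.
split=> [[XT [X1 X2]]|[XT <-]].
  split=> //; rewrite ProjTE X1; move: X2; mx_expand; rewrite X1 => X2.
  by rewrite scaler0 subr0; apply/eqP; rewrite eq_sym -subr_eq0 -X2; apply/eqP; mx_close.
rewrite /tangent trmx_ProjT XT; split=> //.
rewrite !ProjTE; mx_expand; rewrite !(idem, PP).
by split; mx_close.
Qed.

(** For a self-adjoint idempotent, [|Pi X| ^ 2 = <X, Pi X>]; Cauchy-Schwarz then allows cancelling
    one factor. *)
Lemma frob_ProjT X : frob (ProjT P X) <= frob X.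
Proof.
have [->|X0] := eqVneq (frob (ProjT P X)) 0; first exact: frob_ge0.
rewrite -(@ler_pM2r _ (frob (ProjT P X))) ?lt_def ?X0 ?frob_ge0 //.
rewrite -expr2 frob_sqr ip_ProjT ProjT_idem.
exact: le_trans (ler_norm _) (ip_cauchy_schwarz _ _).
Qed.

End TangentProjection.

(** * Functions of class C2 *)

Lemma MVT01 (R : realType) (g dg : R -> R) : (forall s : R, is_derive s 1 g (dg s)) ->
  exists2 t, t \in `]0, 1[ & g 1 - g 0 = dg t.
Proof.
move=> H; have [|t t01] := MVT ltr01 (fun s _ => H s).
  apply: continuous_subspaceT => s; apply: differentiable_continuous.
  by apply/derivable1_diffP; case: (H s).
by rewrite subr0 mulr1; exists t.
Qed.

Section DirectionalDerivatives.
Local Open Scope classical_set_scope.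
Local Open Scope ring_scope.
Variables (R : realType) (V : normedModType R) (f : V -> R).
Implicit Types (x u v : V) (t : R).

Lemma is_derive_line x u t : derivable f (x + t *: u) u ->
  is_derive t 1 (fun s : R => f (x + s *: u)) ('D_u f (x + t *: u)).
Proof.
move=> df; suff E : (fun h : R => h^-1 *: (f (x + (h *: 1 + t) *: u) - f (x + t *: u))) =
   (fun h : R => h^-1 *: (f (h *: u + (x + t *: u)) - f (x + t *: u))).
  by apply: DeriveDef; rewrite /derivable /derive E.
apply/funext => h; congr (_ *: (f _ - _)).
by rewrite [h *: 1]mulr1 scalerDl addrCA.
Qed.

(** Chain rule for the restriction to the line through [x], composed with [s |-> t * s]; this covers
    [t = 0]. *)
Lemma derive_scale_dir x u t : (forall x u, derivable f x u) -> 'D_(t *: u) f x = t * 'D_u f x.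
Proof.
move=> df.
have -> : 'D_(t *: u) f x = ((fun s : R => f (x + s *: u)) \o (fun s : R => t * s))^`()%classic 0.
  have -> : (fun s : R => f (x + s *: u)) \o (fun s : R => t * s) = fun s : R => f (x + s *: (t *: u)).
    by apply/funext => s; rewrite /= scalerA [s * t]mulrC.
  have [_] := is_derive_line (@df (x + 0 *: (t *: u)) (t *: u)).
  by rewrite scale0r addr0 derive1E => ->.
have [dg Dg] := is_derive_line (@df (x + (t * 0) *: u) u).
have dt : is_derive (0 : R) (1 : R) (fun s : R => t * s) t.
  have := @is_deriveM R R (cst t) id 0 1 0 1 (is_derive_cst _ _ _) (is_derive_id _ _).
  by rewrite scaler0 addr0 [_ *: _]mulr1.
rewrite (@derive1_comp R (fun s : R => t * s) _ 0 _ dg); last by case: dt.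
rewrite [X in X * _]derive1E Dg mulr0 scale0r addr0 mulrC; congr (_ * _).
by rewrite derive1E; case: dt.
Qed.

Lemma derive_MVT x u : (forall x, derivable f x u) ->
  exists2 t, t \in `]0, 1[ & f (x + u) - f x = 'D_u f (x + t *: u).
Proof.
move=> df; have [t t01] := MVT01 (fun s => is_derive_line (@df (x + s *: u))).
by rewrite scale1r scale0r addr0; exists t.
Qed.

Lemma continuous_dist (g : V -> R) x (e : R) : {for x, continuous g} -> 0 < e ->
  exists2 d, 0 < d & forall y, `|y - x| < d -> `|g y - g x| <= e.
Proof.
move=> /cvgrPdist_le /(_ e) H e0; have /nbhs_normP[d /= d0 Hd] := H e0.
by exists d => // y yx; rewrite distrC; apply: Hd; rewrite /ball_/= distrC.
Qed.

Lemma dist_continuous (g : V -> R) :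
  (forall x (e : R), 0 < e -> exists2 d, 0 < d & forall y, `|y - x| < d -> `|g y - g x| <= e) ->
  continuous g.
Proof.
move=> H x; apply/cvgrPdist_le => e e0; have [d d0 Hd] := H x e e0.
by apply/nbhs_normP; exists d => // y /=; rewrite /ball_ /= distrC [`|g x - _|]distrC; exact: Hd.
Qed.

Hypotheses (df : forall x u, derivable f x u) (cf : forall u, continuous ('D_u f)).

(** Directional derivatives need not be additive in the direction; their continuity is what forces
    it. The step [h (u + v)] is taken along [h u] and then [h v], with the mean value theorem on
    each leg. *)
Lemma derive_dirD x u v : 'D_(u + v) f x = 'D_u f x + 'D_v f x.
Proof.
have /cvg_lim <- // : h^-1 *: (f (h *: (u + v) + x) - f x) @[h --> 0^'] --> 'D_u f x + 'D_v f x.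
apply/cvgrPdist_le => e e0.
have e20 : 0 < e / 2 by rewrite divr_gt0.
have [d1 d10 H1] := continuous_dist (@cf u x) e20.
have [d2 d20 H2] := continuous_dist (@cf v x) e20.
set d := Num.min d1 d2.
have d0 : 0 < d by rewrite lt_min d10.
have uv0 : 0 < 1 + `|u| + `|v| by rewrite -addrA ltr_wpDr ?addr_ge0.
near=> h.
have h0 : h != 0 by near: h; exact: nbhs_dnbhs_neq.
have hd : `|h| * (1 + `|u| + `|v|) < d.
  rewrite -ltr_pdivlMr //; near: h; apply: dnbhs0_lt; exact: divr_gt0.
have [t1 t1_01 E1] := derive_MVT x (fun x => @df x (h *: u)).
have [t2 t2_01 E2] := derive_MVT (x + h *: u) (fun x => @df x (h *: v)).
have -> : f (h *: (u + v) + x) - f x =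
   h * ('D_u f (x + t1 *: (h *: u)) + 'D_v f (x + h *: u + t2 *: (h *: v))).
  by rewrite mulrDr -!derive_scale_dir // -E1 -E2 scalerDr [_ + x]addrC addrA; ring.
rewrite /GRing.scale /= mulKf // opprD addrACA (le_trans (ler_normD _ _)) // (splitr e).
move: t1_01 t2_01; rewrite !in_itv /= => /andP[t10 t11] /andP[t20 t21].
have ku : `|t1 *: (h *: u)| <= `|h| * `|u|.
  by rewrite !normrZ ger0_norm ?(ltW t10) // ler_piMl ?mulr_ge0 // ltW.
have kv : `|t2 *: (h *: v)| <= `|h| * `|v|.
  by rewrite !normrZ ger0_norm ?(ltW t20) // ler_piMl ?mulr_ge0 // ltW.
have hp : 0 < `|h| by rewrite normr_gt0.
have h1 : 0 <= `|h| * `|u| by rewrite mulr_ge0.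
have h2 : 0 <= `|h| * `|v| by rewrite mulr_ge0.
move: hd; rewrite lt_min !mulrDr mulr1 => /andP[hd1 hd2].
have b1 : `|'D_u f (x + t1 *: (h *: u)) - 'D_u f x| <= e / 2.
  by apply: H1; rewrite [x + _]addrC addrK; lra.
have b2 : `|'D_v f (x + h *: u + t2 *: (h *: v)) - 'D_v f x| <= e / 2.
  apply: H2; rewrite -(addrA x) [x + _]addrC addrK (le_lt_trans (ler_normD _ _)) // normrZ; lra.
by apply: lerD; rewrite distrC; [exact: b1|exact: b2].
Unshelve. all: by end_near.
Qed.

End DirectionalDerivatives.

(** * From continuous directional derivatives to a Frechet expansion *)

Section MatrixC1.
Variables (R : realType) (n : nat) (f : 'M[R]_n -> R).
Hypotheses (df : forall x u, derivable f x u) (cf : forall u, continuous ('D_u f)).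
Implicit Types (x u v D : 'M[R]_n).

Lemma derive_delta x u : 'D_u f x = \sum_i \sum_j u i j * 'D_(delta_mx i j) f x.
Proof.
rewrite {1}(matrix_sum_delta u).
rewrite (big_morph (fun u => 'D_u f x) (derive_dirD df cf x) (derive0 _ _)).
apply: eq_bigr => i _.
rewrite (big_morph (fun u => 'D_u f x) (derive_dirD df cf x) (derive0 _ _)).
by apply: eq_bigr => j _; exact: (derive_scale_dir _ _ _ df).
Qed.

(** Uniformity in the direction comes from the basis: one radius serves the finitely many partial
    derivatives, and every other derivative is a combination of these. *)
Lemma C1_frechet x (e : R) : 0 < e -> exists2 d, 0 < d &
  forall D, frob D < d -> `|f (x + D) - f x - 'D_D f x| <= e * frob D.
Proof.
(* The error is shared among [n ^ 2] partial derivatives; the [+ 1] keeps the divisor positive when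
   [n = 0]. *)
move=> e0; have n0 : 0 < n%:R ^+ 2 + 1 :> R by rewrite ltr_wpDl // sqr_ge0.
have e'0 : 0 < e / (n%:R ^+ 2 + 1) by rewrite divr_gt0.
have /choice[d Hd] : forall p : 'I_n * 'I_n, exists d, 0 < d /\ forall y, `|y - x| < d ->
    `|'D_(delta_mx p.1 p.2) f y - 'D_(delta_mx p.1 p.2) f x| <= e / (n%:R ^+ 2 + 1).
  by move=> p; have [d ? ?] := continuous_dist (@cf (delta_mx p.1 p.2) x) e'0; exists d.
exists (\big[Num.min/1]_p d p).
  by apply: lt_bigmin => // p _; case: (Hd p).
move=> D Dd; have [t] := derive_MVT x (fun x => @df x D).
rewrite in_itv /= => /andP[t0 t1] ->.
rewrite !derive_delta -sumrB.
under eq_bigr do rewrite -sumrB.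
apply: (@le_trans _ _ (\sum_(i < n) \sum_(j < n) frob D * (e / (n%:R ^+ 2 + 1)))).
  apply: le_trans (ler_norm_sum _ _ _) _; apply: ler_sum => i _.
  apply: le_trans (ler_norm_sum _ _ _) _; apply: ler_sum => j _.
  rewrite -mulrBr normrM ler_pM ?frob_entry //.
  have [_ H] := Hd (i, j); apply: H.
  rewrite [x + _]addrC addrK normrZ ger0_norm ?(ltW t0) //.
  apply: le_lt_trans (ler_piMl (normr_ge0 _) (ltW t1)) _.
  apply: le_lt_trans (mxnorm_frob _) _.
  by apply: (lt_le_trans Dd); exact: bigmin_le.
rewrite !sumr_const !card_ord -mulrnA mulnn -[leLHS]mulr_natl natrX.
rewrite mulrCA mulrC; apply: ler_wpM2r; first exact: frob_ge0.
rewrite mulrCA ler_piMr ?ltW // ltr_pdivrMr // mul1r ltrDl //.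
Qed.

(** [C2] demands continuity of the second directional derivatives; applied to a first derivative,
    this lemma yields continuity of the first ones too. *)
Lemma C1_continuous : continuous f.
Proof.
apply: dist_continuous => x e e0.
have [d d0 Hd] := C1_frechet x ltr01.
set M := \sum_i \sum_j `|'D_(delta_mx i j) f x|.
have M0 : 0 <= M by apply: sumr_ge0 => i _; apply: sumr_ge0.
have N0 : 0 < n%:R + 1 :> R by rewrite ltr_wpDl.
have ed0 : 0 < Num.min (d / (n%:R + 1)) (e / ((n%:R + 1) * (1 + M))).
  by rewrite lt_min !divr_gt0 // mulr_gt0 // ltr_wpDr.
exists (Num.min (d / (n%:R + 1)) (e / ((n%:R + 1) * (1 + M)))) => // y.
have [D ->] : exists D, y = x + D by exists (y - x); rewrite addrC subrK.
rewrite [x + _]addrC addrK [D + x]addrC.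
rewrite lt_min => /andP[]; rewrite !ltr_pdivlMr ?mulr_gt0 // ?ltr_wpDr // => yd ye.
have Dn : frob D <= `|D| * (n%:R + 1).
  by have := frob_mxnorm D; have := normr_ge0 D; lra.
have := Hd D (le_lt_trans Dn yd); rewrite mul1r => H.
have H2 : `|'D_D f x| <= M * frob D.
  rewrite derive_delta /M mulr_suml; apply: le_trans (ler_norm_sum _ _ _) _; apply: ler_sum => i _.
  rewrite mulr_suml; apply: le_trans (ler_norm_sum _ _ _) _; apply: ler_sum => j _.
  by rewrite normrM mulrC ler_wpM2l // frob_entry.
rewrite -(subrK ('D_D f x) (f (x + D) - f x)); apply: le_trans (ler_normD _ _) _.
apply: le_trans (lerD H H2) _; apply: (@le_trans _ _ ((1 + M) * (`|D| * (n%:R + 1)))).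
  by rewrite -[X in X + _]mul1r -mulrDl ler_wpM2l // addr_ge0.
rewrite ltW // (le_lt_trans _ ye) // le_eqVlt; apply/orP; left; apply/eqP; ring.
Qed.

End MatrixC1.

(** * Symmetry of second derivatives *)

Section Schwarz.
Variables (R : realType) (V : normedModType R) (f : V -> R).
Implicit Types (x u v : V).
Hypotheses (df : forall x u, derivable f x u)
  (ddf : forall x u v, derivable ('D_u f) x v)
  (cf : forall u v, continuous ('D_v ('D_u f))).

(** The mean value theorem is used twice: for the increment in direction [v] as a function of the
    displacement along [u], then for ['D_u f] along [v]. *)
Lemma mixed_difference x u v : exists s t, [/\ s \in `]0, 1[, t \in `]0, 1[ &
  f (x + u + v) - f (x + v) - (f (x + u) - f x) = 'D_v ('D_u f) (x + s *: u + t *: v)].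
Proof.
have H (s : R) : is_derive s 1 (fun s : R => f ((x + v) + s *: u) - f (x + s *: u))
    ('D_u f (x + v + s *: u) - 'D_u f (x + s *: u)).
  apply: is_deriveB; apply: is_derive_line; exact: df.
have [s s01] := MVT01 H; rewrite !scale1r !scale0r !addr0.
have [t t01] := derive_MVT (x + s *: u) (fun x => @ddf x u v).
rewrite (addrAC x v) (addrAC x v) => -> E; exists s, t; split=> //.
by rewrite -E; lra.
Qed.

(** The second difference over the sides [h u] and [h v] is symmetric in [u] and [v]. After division
    by [h ^ 2] the two mixed derivatives thus agree at two points near [x], and continuity brings
    both to [x]. *)
Lemma schwarz x u v : 'D_v ('D_u f) x = 'D_u ('D_v f) x.
Proof.
apply/eqP; rewrite -subr_eq0 -normr_eq0 eq_le normr_ge0 andbT; apply/ler_addgt0Pr => e e0.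
rewrite add0r.
have e20 : 0 < e / 2 by rewrite divr_gt0.
have [d1 d10 H1] := continuous_dist (@cf u v x) e20.
have [d2 d20 H2] := continuous_dist (@cf v u x) e20.
set d := Num.min d1 d2.
have d0 : 0 < d by rewrite lt_min d10.
have uv0 : 0 < 1 + `|u| + `|v| by rewrite -addrA ltr_wpDr ?addr_ge0.
have [h h0 hd] : exists2 h, 0 < h & h * (`|u| + `|v|) < d.
  exists (d / (1 + `|u| + `|v|)); first by rewrite divr_gt0.
  by rewrite mulrAC ltr_pdivrMr // ltr_pM2l // -addrA ltrDr.
have [s1 [t1 [s101 t101 E1]]] := mixed_difference x (h *: u) (h *: v).
have [s2 [t2 [s201 t201 E2]]] := mixed_difference x (h *: v) (h *: u).
have small s t w z : s \in `]0, 1[ -> t \in `]0, 1[ ->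
    `|(x + s *: (h *: w) + t *: (h *: z)) - x| <= h * (`|w| + `|z|).
  rewrite !in_itv /= => /andP[s_0 s_1] /andP[t_0 t_1].
  rewrite -(addrA x) [x + _]addrC addrK (le_trans (ler_normD _ _)) // mulrDr.
  have hw : 0 <= h * `|w| by rewrite mulr_ge0 // ltW.
  have hz : 0 <= h * `|z| by rewrite mulr_ge0 // ltW.
  rewrite !normrZ (ger0_norm (ltW s_0)) (ger0_norm (ltW t_0)) (ger0_norm (ltW h0)).
  by apply: lerD; apply: ler_piMl => //; exact: ltW.
have D2 y w z : 'D_(h *: z) ('D_(h *: w) f) y = h ^+ 2 * 'D_z ('D_w f) y.
  have -> : 'D_(h *: w) f = (h \*o 'D_w f) by apply/funext => q; exact: derive_scale_dir.
  rewrite (deriveMl (f := 'D_w f) h (@ddf y w _)) (derive_scale_dir _ _ _ (fun x => @ddf x w)); ring.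
have E : 'D_v ('D_u f) (x + s1 *: (h *: u) + t1 *: (h *: v)) =
    'D_u ('D_v f) (x + s2 *: (h *: v) + t2 *: (h *: u)).
  have h20 : h ^+ 2 != 0 by rewrite expf_neq0 // gt_eqF.
  apply: (@mulfI R (h ^+ 2) h20).
  apply: etrans (esym (D2 _ u v)) _; apply: etrans (D2 _ v u).
  rewrite -E1 -E2 [x + h *: v + h *: u]addrAC.
  by rewrite opprB opprB addrACA [RHS]addrACA [- _ - _]addrC.
move: hd; rewrite lt_min => /andP[hd1 hd2].
have {}H1 := H1 _ (le_lt_trans (small _ _ _ _ s101 t101) hd1).
rewrite addrC in hd2; have {}H2 := H2 _ (le_lt_trans (small _ _ _ _ s201 t201) hd2).
rewrite E in H1; rewrite (splitr e) -(subrKA ('D_u ('D_v f) (x + s2 *: (h *: v) + t2 *: (h *: u)))).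
by apply: le_trans (ler_normD _ _) (lerD _ H2); rewrite distrC; exact: H1.
Qed.

End Schwarz.

Lemma trmxE (T : Type) m n (A : 'M[T]_(m, n)) i j : A^T i j = A j i.
Proof. by rewrite mxE. Qed.

Lemma is_derive_quadratic (R : realType) (a b s : R) :
  is_derive s 1 (fun t => t * a + b * t ^+ 2) (a + 2 * b * s).
Proof.
have H : is_derive s (1 : R) (id * cst a + cst b * (id * id) : R -> R) (a + 2 * b * s).
  have h1 := is_deriveM (is_derive_id s (1 : R)) (is_derive_cst a s (1 : R)).
  have h2 := is_deriveM (is_derive_id s (1 : R)) (is_derive_id s (1 : R)).
  have h3 := is_deriveM (is_derive_cst b s (1 : R)) h2.
  apply: (is_derive_eq (is_deriveD h1 h3)); rewrite /GRing.scale /=; ring.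
exact: H.
Qed.

(** * Gradient, Hessian and Taylor expansion of a function of the symmetric part *)

Section SymmetricC2.
Variables (R : realType) (n : nat) (F : 'M[R]_n -> R).
Implicit Types (Q X Y D u : 'M[R]_n).
Hypotheses (FT : forall Q u, F (u^T + Q) = F (u + Q)) (dF : forall x u, derivable F x u)
  (ddF : forall x u v, derivable ('D_u F) x v)
  (cddF : forall u v, continuous ('D_v ('D_u F))).

Definition grad Q : 'M[R]_n := \matrix_(i, j) 'D_(delta_mx j i) F Q.
(** Built from scalar second derivatives, so that the results on real-valued functions apply
    entrywise; [derive_grad] identifies it with the derivative of [grad]. *)
Definition hess Q X : 'M[R]_n := \matrix_(i, j) 'D_X ('D_(delta_mx j i) F) Q.

Let cdF u : continuous ('D_u F).
Proof. exact (C1_continuous (fun x v => @ddF x u v) (fun v => @cddF u v)). Qed.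

Lemma derive_tr Q u : 'D_(u^T) F Q = 'D_u F Q.
Proof.
rewrite /derive.
suff -> : (fun h : R => h^-1 *: (F (h *: u^T + Q) - F Q)) =
  (fun h : R => h^-1 *: (F (h *: u + Q) - F Q)) by [].
by apply/funext => h; rewrite -linearZ /= FT.
Qed.

Lemma derive_trE u : 'D_(u^T) F = 'D_u F.
Proof. by apply/funext => Q; exact: derive_tr. Qed.

Lemma grad_entry Q i j : grad Q i j = 'D_(delta_mx j i) F Q.
Proof. by rewrite mxE. Qed.

Lemma trmx_grad Q : (grad Q)^T = grad Q.
Proof.
by apply/matrixP => i j; rewrite trmxE !grad_entry -(derive_tr Q (delta_mx i j)) trmx_delta.
Qed.

Lemma ip_grad Q u : ip (grad Q) u = 'D_u F Q.
Proof.
rewrite -(trmx_grad Q) (derive_delta dF cdF) ipE; apply: eq_bigr => i _.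
by apply: eq_bigr => j _; rewrite mulrC trmxE grad_entry.
Qed.

Lemma derivable_grad Q X : derivable grad Q X.
Proof.
apply/derivable_mxP => i j.
have -> : (fun P => grad P i j) = 'D_(delta_mx j i) F by apply/funext => P; exact: grad_entry.
exact: ddF.
Qed.

Lemma hess_entry Q X i j : hess Q X i j = 'D_X ('D_(delta_mx j i) F) Q.
Proof. by rewrite mxE. Qed.

Lemma derive_grad Q X : 'D_X grad Q = hess Q X.
Proof.
rewrite derive_mx; last exact: derivable_grad.
apply/matrixP => i j.
rewrite [LHS]mxE.
have -> : (fun P => grad P i j) = 'D_(delta_mx j i) F by apply/funext => P; exact: grad_entry.
by rewrite hess_entry.
Qed.

Lemma hessD Q X Y : hess Q (X + Y) = hess Q X + hess Q Y.
Proof.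
apply/matrixP => i j; rewrite [RHS]addmxE.
apply: (etrans (hess_entry Q (X + Y) i j)).
apply: (etrans _ (esym (congr2 +%R (hess_entry Q X i j) (hess_entry Q Y i j)))).
exact (derive_dirD (fun x u => @ddF x (delta_mx j i) u) (fun v => @cddF (delta_mx j i) v) Q X Y).
Qed.

Lemma hessZ Q a X : hess Q (a *: X) = a *: hess Q X.
Proof.
apply/matrixP => i j; rewrite [RHS]scalemxE.
apply: (etrans (hess_entry Q (a *: X) i j)).
apply: (etrans _ (esym (congr1 ( *%R a) (hess_entry Q X i j)))).
exact (derive_scale_dir Q X a (fun x u => @ddF x (delta_mx j i) u)).
Qed.

Opaque hess grad.

Lemma trmx_hess Q X : (hess Q X)^T = hess Q X.
Proof.
apply/matrixP => i j; rewrite trmxE (hess_entry _ _ j i) (hess_entry _ _ i j).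
have -> : 'D_(delta_mx i j) F = 'D_(delta_mx j i) F.
  have := derive_trE (delta_mx j i); rewrite trmx_delta; exact.
by [].
Qed.

(** The entries of [hess] differentiate along a basis matrix first and [X] second. Schwarz's theorem
    exchanges the two, after which ['D_X F] can be expanded along [Y]. *)
Lemma ip_hess Q X Y : ip (hess Q X) Y = 'D_Y ('D_X F) Q.
Proof.
rewrite -(trmx_hess Q X).
rewrite (derive_delta (fun x u => @ddF x X u) (fun v => @cddF X v)) ipE.
apply: eq_bigr => i _; apply: eq_bigr => j _.
rewrite mulrC; apply: (congr1 ( *%R (Y i j))).
apply: (etrans (trmxE _ _ _)); apply: (etrans (hess_entry _ _ _ _)).
exact (schwarz dF ddF cddF Q (delta_mx i j) X).
Qed.

Lemma hess_selfadjoint Q X Y : ip (hess Q X) Y = ip X (hess Q Y).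
Proof.
apply: (etrans (ip_hess Q X Y)); apply: (etrans (schwarz dF ddF cddF Q X Y)).
by apply: (etrans (esym (ip_hess Q Y X))); exact: ipC.
Qed.

Lemma grad_frechet Q (e : R) : 0 < e -> exists2 d, 0 < d &
  forall D, frob D < d -> frob (grad (Q + D) - grad Q - hess Q D) <= e * frob D.
Proof.
move=> e0; have e'0 : 0 < e / (n%:R + 1) by rewrite divr_gt0 // ltr_wpDl.
have /choice[d Hd] : forall p : 'I_n * 'I_n, exists d, 0 < d /\ forall D, frob D < d ->
    `|(grad (Q + D) - grad Q - hess Q D) p.1 p.2| <= e / (n%:R + 1) * frob D.
  move=> [i j].
  have [d d0 H] := C1_frechet (fun x u => @ddF x (delta_mx j i) u) (fun v => @cddF _ v) Q e'0.
  exists d; split=> // D /H; congr (is_true (`|_| <= _)).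
  rewrite /= (addmxE (grad (Q + D) - grad Q)) oppmxE (addmxE (grad (Q + D))) oppmxE.
  rewrite -(grad_entry Q i j) -(grad_entry (Q + D) i j); congr (_ - _).
  exact (esym (hess_entry Q D i j)).
exists (\big[Num.min/1]_p d p); first by apply: lt_bigmin => // p _; case: (Hd p).
move=> D Dd; apply: le_trans (frob_mxnorm _) _.
apply: (@le_trans _ _ (n%:R * (e / (n%:R + 1) * frob D))).
  apply: ler_wpM2l => //; rewrite [leLHS]mx_normrE; apply: bigmax_le => [|[i j] _].
    by rewrite mulr_ge0 ?frob_ge0 // ltW.
  have [_] := Hd (i, j); apply; apply: (lt_le_trans Dd); exact: bigmin_le.
rewrite mulrA ler_wpM2r ?frob_ge0 // mulrCA ler_piMr ?ltW // ltr_pdivrMr ?ltr_wpDl //.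
by rewrite mul1r ltrDl.
Qed.

(** Along the segment, the difference between [F] and its quadratic polynomial has as derivative the
    pairing of [D] with the first-order remainder of the gradient; the mean value theorem reduces
    the claim to [grad_frechet]. *)
Lemma C2_taylor2 Q (e : R) : 0 < e -> exists2 d, 0 < d &
  forall D, frob D < d -> `|F (Q + D) - F Q - ip (grad Q) D
     - 2^-1 * ip (hess Q D) D| <= e * frob D ^+ 2.
Proof.
move=> e0; have [d d0 H] := grad_frechet Q e0; exists d => // D Dd.
have Hs (s : R) : is_derive s 1 (fun s : R => F (Q + s *: D) -
      (s * ip (grad Q) D + 2^-1 * ip (hess Q D) D * s ^+ 2))
    ('D_D F (Q + s *: D) - (ip (grad Q) D + 2 * (2^-1 * ip (hess Q D) D) * s)).
  exact: (is_deriveB (is_derive_line (@dF (Q + s *: D) D)) (is_derive_quadratic _ _ _)).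
have [t] := MVT01 Hs; rewrite in_itv /= => /andP[t0 t1].
rewrite scale1r scale0r addr0 => Et.
have tD : frob (t *: D) <= frob D by rewrite frobZ (ger0_norm (ltW t0)); apply: ler_piMl; [exact: frob_ge0|exact: ltW].
have -> : F (Q + D) - F Q - ip (grad Q) D - 2^-1 * ip (hess Q D) D =
   ip (grad (Q + t *: D) - grad Q - hess Q (t *: D)) D.
  rewrite hessZ.
  rewrite 2!ipBl ipZl.
  rewrite (ip_grad (Q + t *: D)).
  have lin (a b c h g r : R) : a - (1 * c + 2^-1 * h * 1 ^+ 2) - (b - (0 * c + 2^-1 * h * 0 ^+ 2))
    = g - (c + 2 * (2^-1 * h) * r) -> a - b - c - 2^-1 * h = g - c - r * h by lra.
  exact: lin Et.
apply: le_trans (ip_cauchy_schwarz _ _) _.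
rewrite expr2 mulrA ler_wpM2r ?frob_ge0 //.
apply: le_trans (H _ (le_lt_trans tD Dd)) _; apply: ler_wpM2l; [exact: ltW|exact: tD].
Qed.

End SymmetricC2.

(** * Self-adjoint maps and spectral radius *)

Section LinearMaps.
Variables (R : realType) (n : nat) (A : 'M[R]_n -> 'M[R]_n).
Implicit Types X Y : 'M[R]_n.
Hypotheses (AD : forall X Y, A (X + Y) = A X + A Y) (AZ : forall a X, A (a *: X) = a *: A X).

Lemma linear_mx_bounded : exists2 M, 0 < M & forall X, frob (A X) <= M * frob X.
Proof.
have A0 : A 0 = 0 by have := AZ 0 0; rewrite !scale0r.
pose M := \sum_i \sum_j frob (A (delta_mx i j)).
have M0 : 0 <= M by by apply: sumr_ge0 => i _; apply: sumr_ge0 => j _; exact: frob_ge0.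
have frob_sum (I : finType) (f : I -> 'M[R]_n) : frob (\sum_i f i) <= \sum_i frob (f i).
  elim/big_ind2: _ => [|a b c d H1 H2|//]; first by rewrite frob0.
  exact: le_trans (frobD _ _) (lerD H1 H2).
(* The [+ 1] keeps the bound positive for [A = 0]; its inverse serves later as a step size. *)
exists (M + 1) => [|X]; first by rewrite ltr_wpDl.
apply: (@le_trans _ _ (M * frob X)); last by rewrite ler_wpM2r ?frob_ge0 // lerDl.
rewrite {1}(matrix_sum_delta X) (big_morph A AD A0) mulr_suml.
apply: le_trans (frob_sum _ _) (ler_sum _ _) => i _.
rewrite (big_morph A AD A0) mulr_suml; apply: le_trans (frob_sum _ _) (ler_sum _ _) => j _.
by rewrite AZ frobZ mulrC ler_wpM2l ?frob_ge0 ?frob_entry.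
Qed.

(** Stated on row vectors, where closed bounded sets are known to be compact; [opnorm_attained]
    maximizes this function. *)
Lemma frob_vec_mx_continuous : continuous (fun v : 'rV[R]_(n * n) => frob (A (vec_mx v))).
Proof.
have [M M0 HM] := linear_mx_bounded.
have N0 : 0 < M * (n%:R + 1) by rewrite mulr_gt0 // ltr_wpDl.
apply: dist_continuous => x e e0; exists (e / (M * (n%:R + 1))); first by rewrite divr_gt0.
move=> y; rewrite ltr_pdivlMr // => yx.
have AB X Y : A (X - Y) = A X - A Y by rewrite -scaleN1r AD AZ scaleN1r.
have tri X Y : frob X - frob Y <= frob (X - Y).
  by rewrite lerBlDr -{1}(subrK Y X) frobD.
have H : `|frob (A (vec_mx y)) - frob (A (vec_mx x))| <= frob (A (vec_mx (y - x))).
  rewrite linearB AB ler_norml tri andbT lerNl opprB frobC; exact: tri.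
apply: le_trans H _; apply: le_trans (HM _) _.
have H1 : frob (vec_mx (y - x)) <= n%:R * `|y - x|.
  apply: le_trans (frob_mxnorm _) _; rewrite ler_wpM2l //.
  rewrite [leLHS]mx_normrE; apply: bigmax_le => // -[i j] _ /=.
  rewrite mxE [leRHS]mx_normrE.
  exact: (le_bigmax _ (fun p : 'I_1 * 'I_(n * n) => `|(y - x) p.1 p.2|) (ord0, mxvec_index i j)).
apply: (@le_trans _ _ (M * (n%:R * `|y - x|))); first by rewrite ler_wpM2l // ltW.
have : 0 <= M * `|y - x| by rewrite mulr_ge0 // ltW.
by move: yx; move: (`|y - x|) => d; lra.
Qed.

End LinearMaps.

Section SelfAdjoint.
Local Open Scope classical_set_scope.
Local Open Scope ring_scope.
Variables (R : realType) (n : nat) (A : 'M[R]_n -> 'M[R]_n).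
Implicit Types X Y : 'M[R]_n.
Hypotheses (AD : forall X Y, A (X + Y) = A X + A Y) (AZ : forall a X, A (a *: X) = a *: A X).
Hypothesis A_sa : forall X Y, ip (A X) Y = ip X (A Y).

Lemma opnorm_attained : (exists X : 'M[R]_n, X != 0) ->
  exists2 X0, frob X0 = 1 & forall X, frob (A X) <= frob (A X0) * frob X.
Proof.
move=> [X1 X10].
pose S := [set v : 'rV[R]_(n * n) | frob (vec_mx v) = 1].
have f0 X : X != 0 -> frob X != 0 by apply: contra => /eqP/frob_eq0/eqP.
have Sn X : X != 0 -> S (mxvec ((frob X)^-1 *: X)).
  move=> X0; rewrite /S /= mxvecK frobZ ger0_norm ?invr_ge0 ?frob_ge0 // mulVf //; exact: f0.
have S0 : S !=set0 by exists (mxvec ((frob X1)^-1 *: X1)); exact: Sn.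
have Sc : compact S.
  apply: bounded_closed_compact.
    exists 1; split; first exact: num_real.
    move=> x x1 v /= Sv; apply: le_trans (ltW x1); rewrite -Sv.
    rewrite [leLHS]mx_normrE; apply: bigmax_le => [|[i j] _]; first exact: frob_ge0.
    case/mxvec_indexP: j => k l; rewrite /= (ord1 i) -(vec_mxK v) mxvecE vec_mxK; exact: frob_entry.
  have -> : S = (fun v : 'rV[R]_(n * n) => frob (vec_mx v)) @^-1` [set 1] by [].
  apply: closed_comp; last exact: closed_eq.
  by move=> v _; apply: (@frob_vec_mx_continuous R n id).
have [] := @compact_EVT_max _ R (fun v => frob (A (vec_mx v))) S S0 Sc.
  by apply: continuous_subspaceT; exact: frob_vec_mx_continuous.
move=> v; rewrite inE => Sv Hv; exists (vec_mx v) => // X.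
have [->|X0] := eqVneq X 0.
  by have := AZ 0 0; rewrite !scale0r => ->; rewrite frob0 mulr0.
have Xp : 0 < frob X by rewrite lt_def f0 // frob_ge0.
have := Hv (mxvec ((frob X)^-1 *: X)); rewrite inE => /(_ (Sn X X0)).
by rewrite mxvecK AZ frobZ ger0_norm ?invr_ge0 ?frob_ge0 // mulrC ler_pdivrMr.
Qed.

(* A maximizer [X0] of [frob (A X)] on the unit sphere satisfies [A (A X0) = m ^ 2 X0],
   and then one of [X0] and [A X0 + m X0] is an eigenvector for [- m] or [m]. *)
Lemma selfadjoint_eigen : exists2 m, 0 <= m & (forall X, frob (A X) <= m * frob X) /\
  (m = 0 \/ exists l X, [/\ X != 0, `|l| = m & A X = l *: X]).
Proof.
have [|nX] := pselect (exists X : 'M[R]_n, X != 0); last first.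
  have X0 X : X = 0 by apply/eqP; apply: contra_notT nX => ?; exists X.
  by exists 0 => //; split; [move=> X; rewrite (X0 (A X)) frob0 mul0r|left].
move=> /opnorm_attained[X0 X01 Hm]; set m := frob (A X0) in Hm *.
have m0 : 0 <= m by exact: frob_ge0.
exists m => //; split => //; right.
pose q Y := m ^+ 2 * ip Y Y - ip (A Y) (A Y).
have q0 Y : 0 <= q Y.
  by rewrite /q subr_ge0 -!frob_sqr -exprMn ler_pXn2r ?nnegrE ?mulr_ge0 ?frob_ge0.
have qX0 : q X0 = 0 by rewrite /q -!frob_sqr X01 -/m expr1n mulr1 subrr.
have [Z EZ] : exists Z, Z = m ^+ 2 *: X0 - A (A X0) by exists (m ^+ 2 *: X0 - A (A X0)).
have AN X : A (- X) = - A X by rewrite -scaleN1r AZ scaleN1r.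
have qt t : q (X0 - t *: Z) = - (2 * t * ip Z Z) + t ^+ 2 * q Z.
  have -> : q (X0 - t *: Z) = q X0 - 2 * t * (m ^+ 2 * ip X0 Z - ip (A X0) (A Z)) + t ^+ 2 * q Z.
    by rewrite /q AD AN AZ !ip_lin (ipC Z X0) (ipC (A Z)); ring.
  by rewrite qX0 -A_sa -ipZl -ipBl -EZ; ring.
have Z0 : Z = 0.
  apply: frob_eq0; apply/eqP; rewrite -sqrf_eq0 frob_sqr eq_le ip_ge0 andbT.
  (* With this step [q (X0 - t Z) = - t (|Z| ^ 2 + t)], which is negative unless [Z = 0]; the [+ 1]
     allows for [q Z = 0]. *)
  pose t := ip Z Z / (q Z + 1).
  have qp : 0 < q Z + 1 by rewrite ltr_wpDl.
  rewrite leNgt; apply/negP => Zp.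
  have t0 : 0 < t by rewrite divr_gt0.
  have Et : t * (q Z + 1) = ip Z Z by rewrite /t divfK // gt_eqF.
  have := q0 (X0 - t *: Z); rewrite qt.
  have -> : - (2 * t * ip Z Z) + t ^+ 2 * q Z = t * (- 2 * ip Z Z + (t * (q Z + 1) - t)) by ring.
  rewrite Et pmulr_rge0 //; lra.
have X0n : X0 != 0 by apply: contra_eq_neq X01 => ->; rewrite frob0 eq_sym oner_neq0.
have AA : A (A X0) = m ^+ 2 *: X0 by apply/eqP; rewrite eq_sym -subr_eq0 -EZ Z0.
have [Y0|Y0] := eqVneq (A X0 + m *: X0) 0.
  exists (- m), X0; split=> //; first by rewrite normrN ger0_norm.
  by rewrite scaleNr; apply/eqP; rewrite -addr_eq0 Y0.
exists m, (A X0 + m *: X0); split=> //; first by rewrite ger0_norm.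
by rewrite AD AZ AA scalerDr scalerA expr2 addrC.
Qed.

End SelfAdjoint.

Section SpectralRadius.
Local Open Scope classical_set_scope.
Local Open Scope ring_scope.
Variables (R : realType) (n : nat) (T : 'M[R]_n -> Prop) (pr L : 'M[R]_n -> 'M[R]_n).
Implicit Types X Y : 'M[R]_n.
Hypotheses (LD : forall X Y, L (X + Y) = L X + L Y) (LZ : forall a X, L (a *: X) = a *: L X).
Hypotheses (prD : forall X Y, pr (X + Y) = pr X + pr Y) (prZ : forall a X, pr (a *: X) = a *: pr X).
Hypotheses (pr_sa : forall X Y, ip (pr X) Y = ip X (pr Y)).
Hypotheses (TP : forall X, T X <-> pr X = X) (prT : forall X, T (pr X)).
Hypotheses (LT : forall X, T X -> T (L X))
  (L_sa : forall X Y, T X -> T Y -> ip (L X) Y = ip X (L Y)).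

(** Composing with the projection [pr] extends [L] from [T] to a self-adjoint map of the whole
    matrix space with values in [T]. Its eigenvectors for nonzero eigenvalues therefore lie in
    [T]. *)
Lemma specrad_selfadjoint : (forall X, T X -> frob (L X) <= specrad T L * frob X) /\
  (specrad T L = 0 \/ exists l X, [/\ T X, X != 0, `|l| = specrad T L & L X = l *: X]).
Proof.
pose A X := L (pr X).
have prA X : pr (A X) = A X by apply/TP/LT/prT.
have A_sa X Y : ip (A X) Y = ip X (A Y).
  by rewrite -(prA X) pr_sa /A (L_sa (prT X) (prT Y)) pr_sa -/(A Y) prA.
have AD X Y : A (X + Y) = A X + A Y by rewrite /A prD LD.
have AZ a X : A (a *: X) = a *: A X by rewrite /A prZ LZ.
have [m m0 [Hm Hl]] := selfadjoint_eigen AD AZ A_sa.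
have AL X : T X -> A X = L X by move=> /TP; rewrite /A => ->.
set S := [set rho : R | exists (a b : R) (X Y : 'M[R]_n),
        [/\ T X, T Y, X != 0 \/ Y != 0,
            L X = a *: X - b *: Y /\ L Y = b *: X + a *: Y &
            rho = Num.sqrt (a ^+ 2 + b ^+ 2)]].
(* For a complex eigenvector the cross terms cancel: [|L X| ^ 2 + |L Y| ^ 2 = (a ^ 2 + b ^ 2) (|X| ^
   2 + |Y| ^ 2)]. *)
have Sub : ubound S m.
  move=> rho [a [b [X [Y [TX TY XY [LX LY] ->]]]]].
  have K0 : 0 < ip X X + ip Y Y.
    have ipp Z : Z != 0 -> 0 < ip Z Z.
      move=> Z0; rewrite -frob_sqr exprn_gt0 // lt_def frob_ge0 andbT.
      by apply: contra Z0 => /eqP/frob_eq0/eqP.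
    by case: XY => /ipp H; [rewrite ltr_pwDl // ip_ge0|rewrite ltr_wpDl // ip_ge0].
  have HL Z : T Z -> ip (L Z) (L Z) <= m ^+ 2 * ip Z Z.
    move=> TZ; rewrite -!frob_sqr -exprMn ler_pXn2r ?nnegrE ?mulr_ge0 ?frob_ge0 //.
    by rewrite -AL.
  rewrite -(ger0_norm m0) -sqrtr_sqr ler_sqrt ?sqr_ge0 // -(ler_pM2r K0).
  have -> : (a ^+ 2 + b ^+ 2) * (ip X X + ip Y Y) = ip (L X) (L X) + ip (L Y) (L Y).
    by rewrite LX LY !ip_lin (ipC Y X); ring.
  by rewrite mulrDr; apply: lerD; exact: HL.
have eigS l X : T X -> X != 0 -> L X = l *: X -> S `|l|.
  move=> TX X0 LX; exists l, 0, X, 0; split=> //.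
  - by apply/TP; have := prZ 0 0; rewrite !scale0r.
  - by left.
  - by rewrite LX !scaler0 subr0 scale0r addr0; have := LZ 0 0; rewrite !scale0r.
  - by rewrite expr0n /= addr0 sqrtr_sqr.
have HS : has_ubound S by exists m.
have [mE HE] : specrad T L = m /\ (m = 0 \/ exists l X, [/\ T X, X != 0, `|l| = m & L X = l *: X]).
  (* If [T] is trivial, [S] is empty; the supremum of the empty set is [0] by convention, which is
     then also [m]. *)
  have [m_0|mN0] := eqVneq m 0.
    split; last by left.
    rewrite m_0 /specrad -/S; have [[rho Srho]|/set0P/negP/negPn/eqP ->] := pselect (S !=set0); last exact: sup0.
    apply/le_anti/andP; split; first by rewrite -m_0; apply: ge_sup => //; exists rho.
    apply: le_trans (ub_le_sup HS Srho).
    by case: Srho => [a [b [X [Y [_ _ _ _ ->]]]]]; exact: sqrtr_ge0.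
  case: Hl => [mE|[l [X [X0 lm AX]]]]; first by rewrite mE eqxx in mN0.
  have l0 : l != 0 by rewrite -normr_eq0 lm.
  have TX : T X.
    have -> : X = pr (l^-1 *: A X) by rewrite prZ prA AX scalerA mulVf ?scale1r.
    exact: prT.
  have LX : L X = l *: X by rewrite -AL.
  split; last by right; exists l, X.
  apply/le_anti/andP; split; first by apply: ge_sup => //; exists `|l|; exact: eigS TX X0 LX.
  by rewrite -{1}lm; apply: (ub_le_sup HS); exact: eigS TX X0 LX.
rewrite mE; split=> // X TX; rewrite -AL //; exact: Hm.
Qed.

End SpectralRadius.

(** * The curvature term *)

Section Omega.
Variables (R : realType) (n : nat) (P G : 'M[R]_n).
Implicit Types (X Y : 'M[R]_n).
Hypotheses (PT : P^T = P) (PP : P *m P = P) (GT : G^T = G) (G_crit : ProjT P G = 0).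

Let idem X : X *m P *m P = X *m P. Proof. by rewrite -mulmxA PP. Qed.

(** Multiplying [ProjT P G = 0] by [P] on the left and on the right gives [P G = P G P] and
    [G P = P G P]. *)
Lemma critical_commute : P *m G = G *m P.
Proof.
have := congr1 (mulmx P) G_crit; have := congr1 (mulmx^~ P) G_crit.
rewrite /= !ProjTE; mx_expand; rewrite !(idem, PP) => E1 E2.
apply/eqP; rewrite -subr_eq0; apply/eqP.
by have := congr2 (fun A B => A - B) E2 E1; rewrite subrr => <-; mx_close.
Qed.

Let PG X : X *m P *m G = X *m G *m P. Proof. by rewrite -!mulmxA critical_commute. Qed.

Lemma OmegaD X Y : OmegaOp P G (X + Y) = OmegaOp P G X + OmegaOp P G Y.
Proof. by rewrite /OmegaOp; mx_expand; mx_close. Qed.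

Lemma OmegaZ a X : OmegaOp P G (a *: X) = a *: OmegaOp P G X.
Proof. by rewrite /OmegaOp; mx_expand; mx_close. Qed.

(** The commutator with a symmetric matrix is self-adjoint. The commutators with [P] and with [G]
    commute by the Jacobi identity, since [P G = G P], so their composite is self-adjoint as
    well. *)
Lemma Omega_selfadjoint X Y : ip (OmegaOp P G X) Y = ip X (OmegaOp P G Y).
Proof.
have ad_sa (S A B : 'M[R]_n) : S^T = S -> ip (S *m A - A *m S) B = ip A (S *m B - B *m S).
  by move=> ST; rewrite !ip_lin ipMl ipMr ST.
have jacobi A : P *m (G *m A - A *m G) - (G *m A - A *m G) *m P
    = G *m (P *m A - A *m P) - (P *m A - A *m P) *m G.
  by mx_expand; rewrite critical_commute PG; mx_close.
by rewrite /OmegaOp ipNl ipNr jacobi ad_sa // ad_sa.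
Qed.

(** Any commutator with [P] has zero diagonal blocks relative to [P]. *)
Lemma tangent_Omega X : tangent P X -> tangent P (OmegaOp P G X).
Proof.
move=> /(tangentP PT PP)[XT XP]; apply/(tangentP PT PP); split.
  have CT : (G *m X - X *m G)^T = X *m G - G *m X by rewrite linearB /= !trmx_mul XT GT.
  rewrite /OmegaOp linearN /= linearB /= (trmx_mul P) (trmx_mul _ P) CT PT.
  by mx_expand; mx_close.
by rewrite /OmegaOp !ProjTE; mx_expand; rewrite !(idem, PP); mx_close.
Qed.

Lemma tangent_split X : tangent P X -> X = P *m X + X *m P.
Proof.
move=> tX; have [_ XE] := (tangentP PT PP X).1 tX; have [_ [X1 _]] := tX.
by rewrite -{1}XE ProjTE X1 scaler0 subr0.
Qed.

(** A tangent [X] exchanges the range and the kernel of [P], that is [P X = X (1 - P)]; hence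
    [X ^ 2] preserves both. *)
Lemma tangent_sqr X : tangent P X -> P *m (X *m X) = X *m X *m P /\ P *m (X *m X) *m P = X *m X *m P.
Proof.
move=> tX; have Xs := tangent_split tX.
have E : P *m (X *m X) = X *m X *m P.
  have E1 : P *m X = X - X *m P by rewrite {2}Xs; mx_close.
  have E2 : X *m P = X - P *m X by rewrite {2}Xs; mx_close.
  by rewrite mulmxA E1 -[RHS]mulmxA [in RHS]E2; mx_expand; mx_close.
by split; rewrite E // idem.
Qed.

(** The right-hand side is the derivative of [Q |-> ProjT Q G] at [P] along [X]; this is how [Omega]
    enters the linearized step. *)
Lemma tangent_OmegaE X : tangent P X ->
  OmegaOp P G X = X *m G + G *m X - 2 *: (P *m G *m X) - 2 *: (X *m G *m P).
Proof.
move=> tX; have Xs := tangent_split tX.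
have E1 : X *m G = P *m X *m G + X *m G *m P by rewrite {1}Xs; mx_expand; rewrite PG.
have E2 : G *m X = P *m G *m X + G *m X *m P.
  by rewrite {1}Xs; mx_expand; rewrite -critical_commute.
rewrite {1}E1 {1}E2 /OmegaOp; mx_expand; mx_close.
Qed.

(** By [feasible_defect], the matrix paired with [G] is the leading normal displacement of a
    feasible point with tangent part [X]. *)
Lemma ip_Omega X : tangent P X ->
  ip (OmegaOp P G X) X = 2 * ip G (X *m X - 2 *: (P *m (X *m X) *m P)).
Proof.
move=> tX; have [XT _] := tX; have [E1 E2] := tangent_sqr tX.
rewrite tangent_OmegaE // E2 !ip_lin (ipMl X G) (ipMr G X) (ipMr _ X) -!mulmxA (ipMl P G) (ipMl X) (ipMr G P) XT PT.
by rewrite E1 !mulmxA; ring.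
Qed.

End Omega.

(** * Local orders and linear rates *)

Section LocalOrder.
Variables (R : realType) (n : nat) (S : 'M[R]_n -> Prop).
Implicit Types (f g : 'M[R]_n -> 'M[R]_n) (D : 'M[R]_n) (k l : nat) (e : R).

(** Landau's big O at [0], and with [lino] the little o of order one, both restricted to
    displacements in [S]. *)
Definition powO k f := exists2 C, 0 < C & exists2 d, 0 < d &
  forall D, S D -> frob D < d -> frob (f D) <= C * frob D ^+ k.

Definition lino f := forall e, 0 < e -> exists2 d, 0 < d &
  forall D, S D -> frob D < d -> frob (f D) <= e * frob D.

Lemma powO_ext k f g : (forall D, S D -> f D = g D) -> powO k f -> powO k g.
Proof. by move=> E [C C0 [d d0 H]]; exists C => //; exists d => // D SD; rewrite -E //; exact: H. Qed.

Lemma lino_ext f g : (forall D, S D -> f D = g D) -> lino f -> lino g.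
Proof. by move=> E H e /H[d d0 {}H]; exists d => // D SD; rewrite -E //; exact: H. Qed.

Lemma powO_id : powO 1 id.
Proof. by exists 1 => //; exists 1 => // D _ _; rewrite mul1r expr1. Qed.

Lemma powO_cst A : powO 0 (fun=> A).
Proof.
exists (frob A + 1); first by rewrite ltr_wpDl // frob_ge0.
by exists 1 => // D _ _; rewrite expr0 mulr1 lerDl.
Qed.

Lemma powOD k f g : powO k f -> powO k g -> powO k (fun D => f D + g D).
Proof.
move=> [C C0 [d d0 H]] [C' C'0 [d' d'0 H']].
exists (C + C'); first exact: addr_gt0.
exists (Num.min d d'); first by rewrite lt_min d0.
move=> D SD; rewrite lt_min => /andP[Dd Dd']; rewrite mulrDl.
by apply: le_trans (frobD _ _) _; apply: lerD; [exact: H|exact: H'].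
Qed.

Lemma powOM k l f g : powO k f -> powO l g -> powO (k + l) (fun D => f D *m g D).
Proof.
move=> [C C0 [d d0 H]] [C' C'0 [d' d'0 H']].
exists (C * C'); first exact: mulr_gt0.
exists (Num.min d d'); first by rewrite lt_min d0.
move=> D SD; rewrite lt_min => /andP[Dd Dd']; rewrite exprD mulrACA.
by apply: le_trans (frobM _ _) _; apply: ler_pM; rewrite ?frob_ge0 //; [exact: H|exact: H'].
Qed.

Lemma powO_le f g k : (exists2 M, 0 < M & forall D, frob (g D) <= M * frob (f D)) -> powO k f -> powO k g.
Proof.
move=> [M M0 HM] [C C0 [d d0 H]]; exists (M * C); first exact: mulr_gt0.
exists d => // D SD Dd; rewrite -mulrA; apply: le_trans (HM _) _.
by rewrite ler_pM2l //; exact: H.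
Qed.

Lemma lino_le f g : (exists2 M, 0 < M & forall D, frob (g D) <= M * frob (f D)) -> lino f -> lino g.
Proof.
move=> [M M0 HM] H e e0; have [d d0 Hd] := H (e / M) (divr_gt0 e0 M0).
exists d => // D SD Dd; apply: le_trans (HM _) _.
by rewrite mulrC -ler_pdivlMr // mulrAC; exact: Hd.
Qed.

Lemma frobZ_le a f : exists2 M : R, 0 < M & forall D, frob (a *: f D) <= M * frob (f D).
Proof.
exists (`|a| + 1); first by rewrite ltr_wpDl.
by move=> D; rewrite frobZ ler_wpM2r ?frob_ge0 // lerDl.
Qed.

Lemma powOZ k a f : powO k f -> powO k (fun D => a *: f D).
Proof. exact/powO_le/frobZ_le. Qed.

Lemma powON k f : powO k f -> powO k (fun D => - f D).
Proof. by apply: powO_le; exists 1 => // D; rewrite frobN mul1r. Qed.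

Lemma powOB k f g : powO k f -> powO k g -> powO k (fun D => f D - g D).
Proof. by move=> Hf /powON; exact: powOD. Qed.

Lemma powO_lin k (A : 'M[R]_n -> 'M[R]_n) f : (forall X Y, A (X + Y) = A X + A Y) ->
  (forall a X, A (a *: X) = a *: A X) -> powO k f -> powO k (fun D => A (f D)).
Proof.
move=> AD AZ; have [M M0 HM] := linear_mx_bounded AD AZ.
by apply: powO_le; exists M.
Qed.

Lemma linoZ a f : lino f -> lino (fun D => a *: f D).
Proof. exact/lino_le/frobZ_le. Qed.

Lemma lino_lin (A : 'M[R]_n -> 'M[R]_n) f : (forall X Y, A (X + Y) = A X + A Y) ->
  (forall a X, A (a *: X) = a *: A X) -> lino f -> lino (fun D => A (f D)).
Proof.
move=> AD AZ; have [M M0 HM] := linear_mx_bounded AD AZ.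
by apply: lino_le; exists M.
Qed.

Lemma linoD f g : lino f -> lino g -> lino (fun D => f D + g D).
Proof.
move=> Hf Hg e e0; have e20 : 0 < e / 2 by rewrite divr_gt0.
have [d d0 H] := Hf _ e20; have [d' d'0 H'] := Hg _ e20.
exists (Num.min d d'); first by rewrite lt_min d0.
move=> D SD; rewrite lt_min => /andP[Dd Dd'].
apply: le_trans (frobD _ _) _; rewrite (splitr e) mulrDl.
by apply: lerD; [exact: H|exact: H'].
Qed.

Lemma powO_small k f e : powO k.+1 f -> 0 < e -> exists2 d, 0 < d &
  forall D, S D -> frob D < d -> frob (f D) <= e * frob D ^+ k.
Proof.
move=> [C C0 [d d0 H]] e0; exists (Num.min d (e / C)); first by rewrite lt_min d0 divr_gt0.
move=> D SD; rewrite lt_min => /andP[Dd De]; apply: le_trans (H _ SD Dd) _.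
rewrite exprS mulrA ler_wpM2r ?exprn_ge0 ?frob_ge0 //.
by rewrite mulrC -ler_pdivlMr // ltW.
Qed.

Lemma powO_lino f : powO 2 f -> lino f.
Proof. by move=> Hf e e0; have [d d0 H] := powO_small Hf e0; exists d. Qed.

Lemma lino_powO f : lino f -> powO 1 f.
Proof. by move=> /(_ 1 ltr01)[d d0 H]; exists 1 => //; exists d. Qed.

Lemma powOS k f : powO k.+1 f -> powO k f.
Proof. by move=> Hf; exists 1 => //; exact: powO_small. Qed.

End LocalOrder.

(** The basin [delta] must not depend on [theta], so it is fixed by one contraction factor [q]
    between [r] and [1]. For a given [theta], [K] steps bring the whole basin into the smaller ball
    where the factor is [r + theta]; the constant [C] absorbs these steps. *)
Lemma linear_rate (R : realType) (T : Type) (S : T -> Prop) (Phi : T -> T) (d : T -> R) (r : R) :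
  0 <= r -> r < 1 -> (forall P, 0 <= d P) ->
  (forall e, 0 < e -> exists2 de, 0 < de &
     forall P, S P -> d P < de -> S (Phi P) /\ d (Phi P) <= (r + e) * d P) ->
  exists2 delta, 0 < delta & forall theta, 0 < theta -> exists2 C, 0 < C &
    forall P, S P -> d P < delta -> forall k, d (iter k Phi P) <= C * (r + theta) ^+ k * d P.
Proof.
move=> r0 r1 dP0 Hloc.
have e0 : 0 < (1 - r) / 2 by rewrite divr_gt0 // subr_gt0.
have [delta delta0 Hd] := Hloc _ e0; set q := r + (1 - r) / 2 in Hd.
have q0 : 0 <= q by rewrite addr_ge0 // ltW.
have q1 : q < 1 by rewrite /q; lra.
exists delta => // theta th0; have [d1 d10 H1] := Hloc _ th0.
have basin P : S P -> d P < delta -> forall k, S (iter k Phi P) /\ d (iter k Phi P) <= q ^+ k * d P.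
  move=> SP Pd; elim=> [|k [Sk dk]]; first by rewrite expr0 mul1r.
  have : d (iter k Phi P) < delta.
    apply: le_lt_trans Pd; apply: le_trans dk _.
    by rewrite ler_piMl //; apply: exprn_ile1 => //; exact: ltW.
  move=> /(Hd _ Sk)[SS ds]; split=> //=; apply: le_trans ds _.
  by rewrite exprS -mulrA ler_wpM2l.
have qn : `|q| < 1 by rewrite ger0_norm.
have [K HK] : exists K, q ^+ K * delta < d1.
  have /cvgrPdist_lt/(_ d1 d10)[K _ HK] := @cvg_geometric R delta q qn.
  exists K; have := HK K (leqnn K).
  have g0 : 0 <= delta * q ^+ K by apply: mulr_ge0; [exact: ltW|exact: exprn_ge0].
  by rewrite /geometric /= sub0r normrN (ger0_norm g0) mulrC.
have rt0 : 0 < r + theta by rewrite ltr_wpDl.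
(* This dominates [(r + theta) ^ (- k)] for every [k <= K], whether [r + theta] is below or above
   [1]. *)
set C := (1 + (r + theta)^-1) ^+ K.
have i0 : 0 < (r + theta)^-1 by rewrite invr_gt0.
have C0 : 0 < C by rewrite exprn_gt0 // addr_gt0.
exists C => // P SP Pd.
have early k : (k <= K)%N -> d (iter k Phi P) <= C * (r + theta) ^+ k * d P.
  move=> kK; have [_] := basin P SP Pd k.
  move/le_trans; apply; apply: ler_wpM2r => //; apply: (@le_trans _ _ 1).
    by apply: exprn_ile1 => //; exact: ltW.
  rewrite -ler_pdivrMr ?exprn_gt0 // mul1r -exprVn.
  apply: (@le_trans _ _ ((1 + (r + theta)^-1) ^+ k)).
    by apply: lerXn2r; rewrite ?nnegrE ?lerDr // ltW // addr_gt0.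
  by apply: ler_weXn2l => //; rewrite lerDl ltW.
have late j : d (iter (j + K) Phi P) <= C * (r + theta) ^+ (j + K) * d P.
  elim: j => [|j IH]; first exact: early.
  have [Sj dj] := basin P SP Pd (j + K)%N.
  have : d (iter (j + K) Phi P) < d1.
    apply: le_lt_trans HK; apply: le_trans dj _.
    apply: ler_pM => //; first exact: exprn_ge0.
      by rewrite exprD ler_piMl ?exprn_ge0 //; apply: exprn_ile1 => //; exact: ltW.
    exact: ltW.
  move=> /(H1 _ Sj)[_ ds]; rewrite addSn /=; apply: le_trans ds _.
  rewrite exprS mulrCA -!mulrA; apply: ler_wpM2l; first exact: ltW.
  by move: IH; rewrite -!mulrA.
move=> k; have [kK|kK] := leqP k K; first exact: early.
by rewrite -(subnK (ltnW kK)); exact: late.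
Qed.

(** * Projected gradient steps near a minimizer *)

Section Symmetrization.
Variables (R : realType) (n : nat).
Implicit Types (X Y P : 'M[R]_n).

Lemma symz_tr X : symz X^T = symz X.
Proof. by rewrite /symz trmxK addrC. Qed.

Lemma trmx_symz X : (symz X)^T = symz X.
Proof. by rewrite /symz linearZ /= linearD /= trmxK addrC. Qed.

Lemma symzD X Y : symz (X + Y) = symz X + symz Y.
Proof. by apply/matrixP => i j; rewrite !mxE; ring. Qed.

Lemma symzZ a X : symz (a *: X) = a *: symz X.
Proof. by apply/matrixP => i j; rewrite !mxE; ring. Qed.

Lemma symz_id X : X^T = X -> symz X = X.
Proof. by rewrite /symz => ->; apply/matrixP => i j; rewrite scalemxE addmxE; lra. Qed.

Lemma ip_symz X Y : ip (symz X) Y = ip X (symz Y).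
Proof.
have ipT A B : ip A^T B = ip A B^T by rewrite /ip trmxK -mxtrace_tr trmx_mul mxtrace_mulC.
by rewrite /symz !(ipZl, ipZr, ipDl, ipDr) ipT.
Qed.

Lemma ProjT_symz P X : P^T = P -> ProjT P (symz X) = symz (ProjT P X).
Proof. by move=> PT; rewrite /symz ProjTZ ProjTD trmx_ProjT. Qed.

End Symmetrization.

(** Stands for the limit [s -> 0] along feasible curves, in the proofs of criticality and of
    coercivity. *)
Lemma ler0_linear (R : realType) (a K d : R) : 0 < d ->
  (forall s, 0 < s -> s < d -> a <= K * s) -> a <= 0.
Proof.
move=> d0 H; rewrite leNgt; apply/negP => a0.
have K0 : 0 < `|K| + 1 by rewrite ltr_wpDl.
pose s := Num.min (d / 2) (a / (2 * (`|K| + 1))).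
have s0 : 0 < s by rewrite lt_min !divr_gt0 // mulr_gt0.
have sd : s < d by rewrite gt_min ltr_pdivrMr //; apply/orP; left; lra.
have sa : s * (2 * (`|K| + 1)) <= a by rewrite -ler_pdivlMr ?mulr_gt0 // ge_min lexx orbT.
have := H s s0 sd; have : K * s <= `|K| * s by rewrite ler_pM2r // ler_norm.
have : 0 <= `|K| * s by rewrite mulr_ge0 // ltW.
move: sa; lra.
Qed.

(* The paper's [J_grad], with [G] and [H] standing for the gradient and the Hessian at [P]. *)
Definition riem_hess (R : realType) (n : nat) (P G : 'M[R]_n) (H : 'M[R]_n -> 'M[R]_n)
  (X : 'M[R]_n) : 'M[R]_n := OmegaOp P G X + ProjT P (H (ProjT P X)).

Section LocalAnalysis.
Variables (R : realType) (n N : nat) (F : 'M[R]_n -> R) (g H Rt : 'M[R]_n -> 'M[R]_n) (P : 'M[R]_n).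
Implicit Types (X Y D Q : 'M[R]_n).
Local Notation G := (g P).
Local Notation S := (fun D => MN N (P + D)).
Local Notation J := (riem_hess P G H).
Hypotheses (MP : MN N P) (gT : forall Q, (g Q)^T = g Q) (HT : forall X, (H X)^T = H X).
Hypotheses (HD : forall X Y, H (X + Y) = H X + H Y) (HZ : forall a X, H (a *: X) = a *: H X).
Hypothesis H_sa : forall X Y, ip (H X) Y = ip X (H Y).
Hypothesis g_frechet : forall e : R, 0 < e -> exists2 d, 0 < d &
  forall D, frob D < d -> frob (g (P + D) - g P - H D) <= e * frob D.
Hypothesis F_taylor : forall e : R, 0 < e -> exists2 d, 0 < d &
  forall D, frob D < d -> `|F (P + D) - F P - ip (g P) D - 2^-1 * ip (H D) D| <= e * frob D ^+ 2.
Variables (eta rho d0 C0 : R).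
Hypotheses (eta0 : 0 < eta) (rho0 : 0 < rho) (d0_gt0 : 0 < d0) (C0_gt0 : 0 < C0).
Hypothesis P_min : forall Q, MN N Q -> frob (Q - P) < rho -> F P + eta * frob (Q - P) ^+ 2 <= F Q.
Hypothesis Rt_expand : forall X, X^T = X -> frob X < d0 ->
  MN N (Rt (P + X)) /\ frob (Rt (P + X) - P - ProjT P X) <= C0 * frob X ^+ 2.

Let PT : P^T = P. Proof. by case: MP. Qed.
Let PP : P *m P = P. Proof. by case: MP => _ []. Qed.

Lemma feasible_sym D : S D -> D^T = D.
Proof. by move=> [+ _]; rewrite linearD /= PT => /addrI. Qed.

(** Idempotency of [P + D] reads [D = P D + D P + D ^ 2], and compressing it by [P] gives
    [P D P = - P D ^ 2 P]. The exact formula is kept because its quadratic part, paired with [G],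
    produces [Omega]. *)
Lemma feasible_defect D : S D -> D - ProjT P D = D *m D - 2 *: (P *m (D *m D) *m P).
Proof.
move=> [_ [PD _]].
have E : D = P *m D + D *m P + D *m D.
  by apply: (@addrI _ P); rewrite -{1}PD; mx_expand; rewrite PP; mx_close.
have E2 : P *m D *m P = - (P *m (D *m D) *m P).
  have := congr1 (fun Z => P *m Z *m P) E; rewrite /= !mulmxDr !mulmxDl !mulmxA PP -!(mulmxA _ P P) PP.
  move=> /eqP; rewrite eq_sym -subr_eq0 => /eqP E3.
  by apply/eqP; rewrite -subr_eq0 -E3; apply/eqP; mx_close.
by rewrite {1}E ProjTE E2; mx_close.
Qed.

Lemma powO_defect : powO S 2 (fun D => D - ProjT P D).
Proof.
apply: powO_ext; first by move=> D SD; rewrite feasible_defect.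
apply: powOB; first exact: (powOM (powO_id _) (powO_id _)).
apply: powOZ; apply: (powOM (k := 2) (l := 0)); last exact: powO_cst.
by apply: (powOM (k := 0) (l := 2)); [exact: powO_cst|exact: (powOM (powO_id _) (powO_id _))].
Qed.

Lemma powO_ProjT : powO S 1 (ProjT P).
Proof. by apply: (powO_lin (A := ProjT P) _ _ (powO_id _)); [exact: ProjTD|exact: ProjTZ]. Qed.

(** The retraction of [P + t X] realizes any tangent direction by feasible points. *)
Lemma feasible_curve X : tangent P X -> exists2 C, 0 < C & exists2 d, 0 < d &
  forall t, `|t| < d -> exists2 D, S D & frob (D - t *: X) <= C * t ^+ 2.
Proof.
move=> tX; have [XT XP] := (tangentP PT PP X).1 tX.
have X1 : 0 < frob X + 1 by rewrite ltr_wpDl // frob_ge0.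
exists (C0 * frob X ^+ 2 + 1); first by rewrite ltr_wpDl // mulr_ge0 ?sqr_ge0 // ltW.
exists (d0 / (frob X + 1)); first exact: divr_gt0.
move=> t; rewrite ltr_pdivlMr // => td.
have [||M1 M2] := Rt_expand (X := t *: X); first by rewrite linearZ /= XT.
  rewrite frobZ; apply: le_lt_trans td; apply: ler_wpM2l => //; by rewrite lerDl.
exists (Rt (P + t *: X) - P); first by rewrite addrC subrK.
move: M2; rewrite ProjTZ XP => M2; apply: le_trans M2 _.
rewrite frobZ exprMn real_normK ?num_real // mulrDl mul1r mulrCA mulrC lerDl; exact: sqr_ge0.
Qed.

Let HM : exists2 M, 0 < M & forall X, frob (H X) <= M * frob X.
Proof. exact: linear_mx_bounded. Qed.

(** Along the feasible curve in the direction [- X], with [X] the projected gradient, the energy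
    would drop by [s |X| ^ 2] up to [O(s ^ 2)], which minimality forbids for small [s] unless
    [X = 0]. *)
Lemma minimizer_critical : ProjT P G = 0.
Proof.
set X := ProjT P G.
have tX : tangent P X by apply/(tangentP PT PP); rewrite trmx_ProjT // gT ProjT_idem.
have [C C0' [d1 d10 Hcurve]] := feasible_curve tX.
have [d2 d20 Htay] := F_taylor ltr01.
have [M M0 HM'] := HM.
(* For [s < 1] the curve satisfies [|D| <= s |X| + C s ^ 2 <= s a]. *)
pose a := frob X + C.
have a0 : 0 < a by rewrite ltr_wpDl // frob_ge0.
pose d := Num.min (Num.min 1 d1) (Num.min (d2 / a) (rho / a)).
have dp : 0 < d by rewrite !lt_min ltr01 d10 !divr_gt0.
(* [K s ^ 2] collects the deviation of the curve paired with [G], the Taylor error and the Hessian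
   term. *)
pose K := frob G * C + (1 + M) * a ^+ 2.
apply: frob_eq0; apply/eqP; rewrite -sqrf_eq0 eq_le sqr_ge0 andbT; apply/eqP.
apply/eqP; apply: (@ler0_linear _ _ K d dp) => s s0.
rewrite !lt_min => /andP[/andP[s1 sd1] /andP[]]; rewrite !ltr_pdivlMr // => sd2 srho.
have [|D SD HD'] := Hcurve (- s); first by rewrite normrN gtr0_norm.
have ip1 : ip G D <= - s * frob X ^+ 2 + frob G * (C * s ^+ 2).
  have -> : ip G D = - s * frob X ^+ 2 + ip G (D - - s *: X).
    by rewrite frob_sqr /X ip_ProjT // ProjT_idem // !ip_lin; ring.
  rewrite lerD2l; apply: le_trans (ler_norm _) _; apply: le_trans (ip_cauchy_schwarz _ _) _.
  by rewrite ler_wpM2l ?frob_ge0 //; move: HD'; rewrite sqrrN.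
have Ds : frob D <= s * a.
  rewrite -(subrK (- s *: X) D); apply: le_trans (frobD _ _) _.
  rewrite frobZ normrN gtr0_norm // /a mulrDr addrC lerD2l; apply: le_trans HD' _.
  by rewrite sqrrN mulrC ler_pM2r // expr2 ler_piMr // ltW.
have Dd2 := le_lt_trans Ds sd2; have Drho := le_lt_trans Ds srho.
have := Htay D Dd2; rewrite mul1r => /(le_trans (ler_norm _)) T1.
have := P_min SD; rewrite [P + D]addrC addrK [D + P]addrC => /(_ Drho) T2.
have T3 : 0 <= eta * frob D ^+ 2 by rewrite mulr_ge0 ?sqr_ge0 // ltW.
have T4 : ip (H D) D <= M * frob D ^+ 2.
  apply: le_trans (ler_norm _) _; apply: le_trans (ip_cauchy_schwarz _ _) _.
  by rewrite expr2 mulrA ler_wpM2r ?frob_ge0.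
have T5 : frob D ^+ 2 <= (s * a) ^+ 2 by rewrite ler_pXn2r ?nnegrE ?frob_ge0 // mulr_ge0 // ltW.
have T6 : M * frob D ^+ 2 <= M * (s * a) ^+ 2 by rewrite ler_pM2l.
have T7 : 0 <= M * (s * a) ^+ 2 by rewrite mulr_ge0 ?sqr_ge0 // ltW.
rewrite -(ler_pM2l s0) /K; move: T1 T2 T3 T4 T5 T6 T7 ip1; rewrite !exprMn.
move: (frob X ^+ 2) (frob D ^+ 2) (F (P + D)) (F P) (ip G D) (ip (H D) D) => x y f1 f2 i1 i2.
lra.
Qed.

Lemma riem_hessD X Y : J (X + Y) = J X + J Y.
Proof. by rewrite /riem_hess OmegaD !(ProjTD, HD) addrACA. Qed.

Lemma riem_hessZ a X : J (a *: X) = a *: J X.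
Proof. by rewrite /riem_hess OmegaZ !(ProjTZ, HZ) [RHS]scalerDr. Qed.

Lemma riem_hess_selfadjoint X Y : ip (J X) Y = ip X (J Y).
Proof.
by rewrite /riem_hess ipDl ipDr (Omega_selfadjoint PT PP (gT P) minimizer_critical) !ip_ProjT // H_sa ip_ProjT.
Qed.

Lemma tangent_riem_hess X : tangent P X -> tangent P (J X).
Proof.
move=> tX; apply/(tangentP PT PP).
have /(tangentP PT PP)[OT OP] := tangent_Omega PT PP (gT P) tX.
by rewrite /riem_hess linearD /= trmx_ProjT // HT OT ProjTD OP ProjT_idem.
Qed.

Lemma ip_riem_hess X : tangent P X -> ip (J X) X =
  2 * ip G (X *m X - 2 *: (P *m (X *m X) *m P)) + ip (H X) X.
Proof.
move=> tX; have [_ XP] := (tangentP PT PP X).1 tX.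
by rewrite /riem_hess ipDl (ip_Omega PT PP minimizer_critical tX) ip_ProjT // XP.
Qed.

Lemma tangent_ProjT D : S D -> tangent P (ProjT P D).
Proof.
by move=> /feasible_sym DT; apply/(tangentP PT PP); rewrite trmx_ProjT // DT ProjT_idem.
Qed.

(** Criticality gives [<G, D> = <G, D - Pi D>], so the linear term is quadratic by
    [feasible_defect]. The three shares [e / 3] pay for the Taylor remainder, for replacing [D ^ 2]
    by [X ^ 2] with [X = Pi D], and for replacing [D] by [X] in the Hessian form. *)
Lemma energy_expand (e : R) : 0 < e -> exists2 d, 0 < d & forall D, S D -> frob D < d ->
  `|F (P + D) - F P - 2^-1 * ip (J (ProjT P D)) (ProjT P D)| <= e * frob D ^+ 2.
Proof.
move=> e0; have e30 : 0 < e / 3 by rewrite divr_gt0.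
have [d1 d10 H1] := F_taylor e30.
have [M M0 HM'] := HM.
(* This is [D ^ 2 - X ^ 2], written so that each term has the quadratic factor [D - Pi D] and is
   thus of third order. *)
pose Z D := D *m (D - ProjT P D) + (D - ProjT P D) *m ProjT P D.
have Z3 : powO S 3 Z.
  apply: powOD; first exact: (powOM (k := 1) (l := 2) (powO_id _) powO_defect).
  exact: (powOM (k := 2) (l := 1) powO_defect powO_ProjT).
have W3 : powO S 3 (fun D => Z D - 2 *: (P *m Z D *m P)).
  apply: powOB => //; apply: powOZ; apply: (powOM (k := 3) (l := 0)); last exact: powO_cst.
  by apply: (powOM (k := 0) (l := 3)); first exact: powO_cst.
have G0 : 0 < frob G + 1 by rewrite ltr_wpDl // frob_ge0.
have [d2 d20 H2] := powO_small W3 (divr_gt0 e30 G0).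
have [d3 d30 H3] := powO_small powO_defect (divr_gt0 e30 M0).
exists (Num.min d1 (Num.min d2 d3)); first by rewrite !lt_min d10 d20.
move=> D SD; rewrite !lt_min => /and3P[D1 D2 D3].
set X := ProjT P D; have tX : tangent P X by exact: tangent_ProjT.
have EG : ip G D = ip G (X *m X - 2 *: (P *m (X *m X) *m P)) + ip G (Z D - 2 *: (P *m Z D *m P)).
  have -> : ip G D = ip G (D - X).
    by rewrite ipBr /X -ip_ProjT // minimizer_critical ip0l subr0.
  have EZ : D *m D = X *m X + Z D.
    by rewrite /Z -/X; clear; move: X => X; mx_expand; mx_close.
  rewrite feasible_defect // -ipDr EZ; congr (ip _ _).
  by clear; move: (Z D) X => Z1 X; mx_expand; mx_close.
have EH : ip (H D) D - ip (H X) X = ip (H D + H X) (D - X).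
  have E1 : ip (H X) D = ip (H D) X by rewrite H_sa ipC.
  by rewrite ipDl (ipBr (H D)) (ipBr (H X)) E1; ring.
rewrite ip_riem_hess //.
have {}H1 := H1 D D1; have {}H2 := H2 D SD D2; have {}H3 := H3 D SD D3.
have B2 : `|ip G (Z D - 2 *: (P *m Z D *m P))| <= e / 3 * frob D ^+ 2.
  apply: le_trans (ip_cauchy_schwarz _ _) _.
  apply: (@le_trans _ _ ((frob G + 1) * (e / 3 / (frob G + 1) * frob D ^+ 2))).
    by apply: ler_pM; rewrite ?frob_ge0 // lerDl.
  by rewrite mulrA [_ * (_ / _)]mulrC divfK // gt_eqF.
have B3 : `|2^-1 * ip (H D + H X) (D - X)| <= e / 3 * frob D ^+ 2.
  rewrite normrM ger0_norm ?invr_ge0 // mulrC ler_pdivrMr //.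
  apply: le_trans (ip_cauchy_schwarz _ _) _.
  apply: (@le_trans _ _ (2 * M * frob D * (e / 3 / M * frob D ^+ 1))).
    apply: ler_pM; rewrite ?frob_ge0 //.
    apply: le_trans (frobD _ _) _; have := HM' D; have := HM' X.
    have : M * frob X <= M * frob D by rewrite ler_pM2l // frob_ProjT.
    by move: (frob D) (frob X) => x y; lra.
  have -> : 2 * M * frob D * (e / 3 / M * frob D ^+ 1) = (M * (e / 3 / M)) * frob D ^+ 2 * 2 by ring.
  by rewrite [M * _]mulrC divfK // gt_eqF.
have -> : F (P + D) - F P - 2^-1 * (2 * ip G (X *m X - 2 *: (P *m (X *m X) *m P)) + ip (H X) X) =
   (F (P + D) - F P - ip G D - 2^-1 * ip (H D) D) + ip G (Z D - 2 *: (P *m Z D *m P))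
   + 2^-1 * ip (H D + H X) (D - X).
  rewrite -EH EG.
  move: (F (P + D)) (F P) (ip G _) (ip G _) (ip (H D) D) (ip (H X) X) => *; lra.
apply: le_trans (ler_normD _ _) _; have := le_trans (ler_normD _ _) (lerD H1 B2) => B12.
apply: le_trans (lerD B12 B3) _.
by move: (frob D ^+ 2) => x; lra.
Qed.

Lemma riem_hess_coercive_feasible : exists2 d, 0 < d & forall D, S D -> frob D < d ->
  eta * frob (ProjT P D) ^+ 2 <= ip (J (ProjT P D)) (ProjT P D).
Proof.
(* Half of [eta] pays for the error; the factor [1 / 2] in the expansion restores the full [eta]. *)
have e0 : 0 < eta / 2 by rewrite divr_gt0.
have [d d_0 Hd] := energy_expand e0; exists (Num.min d rho); first by rewrite lt_min d_0.
move=> D SD; rewrite lt_min => /andP[Dd Drho].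
have := Hd D SD Dd => /(le_trans (ler_norm _)) T1.
have := P_min SD; rewrite [P + D]addrC addrK [D + P]addrC => /(_ Drho) T2.
have T3 : eta * frob (ProjT P D) ^+ 2 <= eta * frob D ^+ 2.
  by rewrite ler_pM2l // ler_pXn2r ?nnegrE ?frob_ge0 // frob_ProjT.
move: T1 T2 T3.
move: (F _) (F _) (ip _ _) (frob D ^+ 2) (frob _ ^+ 2) => f1 f2 i x y; lra.
Qed.

(** The previous bound covers only projections of feasible displacements. Along the curve these are
    [s X + O(s ^ 2)], and dividing by [s ^ 2] gives the bound at [X] itself in the limit. *)
Lemma riem_hess_coercive X : tangent P X -> eta * frob X ^+ 2 <= ip (J X) X.
Proof.
move=> tX; have [XT XP] := (tangentP PT PP X).1 tX.
have [M M0 HMJ] := linear_mx_bounded riem_hessD riem_hessZ.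
have [d d_0 Hd] := riem_hess_coercive_feasible.
have [C C_0 [d1 d10 Hcurve]] := feasible_curve tX.
pose a := frob X + C.
have a0 : 0 < a by rewrite ltr_wpDl // frob_ge0.
(* With [W = O(s ^ 2)] the deviation from [s X], [K s ^ 3] bounds the cross terms between [s X] and
   [W], and the terms quadratic in [W] because [s ^ 4 <= s ^ 3]. *)
pose K := (2 * (M + eta) * frob X * C + (M + eta) * C ^+ 2).
have dp : 0 < Num.min 1 (Num.min d1 (d / a)) by rewrite !lt_min ltr01 d10 divr_gt0.
rewrite -subr_le0; apply: (@ler0_linear _ _ K _ dp) => s s0.
rewrite !lt_min => /and3P[s1 sd1]; rewrite ltr_pdivlMr // => sd.
have [|D SD HD'] := Hcurve s; first by rewrite gtr0_norm.
have Ds : frob D <= s * a.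
  rewrite -(subrK (s *: X) D); apply: le_trans (frobD _ _) _.
  rewrite frobZ gtr0_norm // /a mulrDr addrC lerD2l; apply: le_trans HD' _.
  by rewrite mulrC ler_pM2r // expr2 ler_piMr // ltW.
have := Hd D SD (le_lt_trans Ds sd).
have [W EW] : exists W, W = ProjT P (D - s *: X) by exists (ProjT P (D - s *: X)).
have -> : ProjT P D = s *: X + W by rewrite EW ProjTB ProjTZ XP addrC subrK.
have Ws : frob W <= C * s ^+ 2 by rewrite EW; apply: le_trans (frob_ProjT PT PP _) HD'.
have Jq Y Z : `|ip (J Y) Z| <= M * frob Y * frob Z.
  by apply: le_trans (ip_cauchy_schwarz _ _) _; rewrite ler_wpM2r ?frob_ge0.
have s20 : 0 < s ^+ 2 by rewrite exprn_gt0.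
have s2W : s ^+ 4 <= s ^+ 3 by rewrite ler_wiXn2l // ltW.
have b1 : ip (J X) W <= M * frob X * (C * s ^+ 2).
  apply: le_trans (ler_norm _) _; apply: le_trans (Jq _ _) _; apply: ler_wpM2l => //.
  by rewrite mulr_ge0 ?frob_ge0 // ltW.
have b2 : ip (J W) W <= M * (C * s ^+ 2) ^+ 2.
  apply: le_trans (ler_norm _) _; apply: le_trans (Jq _ _) _; rewrite -mulrA ler_pM2l //.
  by rewrite expr2; apply: ler_pM; rewrite ?frob_ge0.
have b3 : - ip X W <= frob X * (C * s ^+ 2).
  rewrite -ipNr; apply: le_trans (ler_norm _) _; apply: le_trans (ip_cauchy_schwarz _ _) _.
  by rewrite frobN ler_wpM2l ?frob_ge0.
have b4 : 0 <= ip W W by exact: ip_ge0.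
have b4' : 0 <= eta * ip W W by rewrite mulr_ge0 // ltW.
have b1' : s * ip (J X) W <= s * (M * frob X * (C * s ^+ 2)) by rewrite ler_pM2l.
have b3' : s * (eta * - ip X W) <= s * (eta * (frob X * (C * s ^+ 2))) by rewrite !ler_pM2l.
have b5 : (M * C ^+ 2) * s ^+ 4 <= (M * C ^+ 2) * s ^+ 3.
  by apply: ler_wpM2l => //; rewrite mulr_ge0 ?sqr_ge0 // ltW.
have b6 : 0 <= (eta * C ^+ 2) * s ^+ 3 by rewrite !mulr_ge0 ?sqr_ge0 ?exprn_ge0 // ltW.
have -> : ip (J (s *: X + W)) (s *: X + W) = s ^+ 2 * ip (J X) X + 2 * s * ip (J X) W + ip (J W) W.
  have E1 : ip (J W) X = ip (J X) W by rewrite riem_hess_selfadjoint ipC.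
  rewrite riem_hessD riem_hessZ; move: (J X) (J W) E1 => jX jW E1.
  by rewrite !(ipDl, ipDr, ipZl, ipZr) E1; ring.
have -> : frob (s *: X + W) ^+ 2 = s ^+ 2 * ip X X + 2 * s * ip X W + ip W W.
  by rewrite frob_sqr !(ipDl, ipDr, ipZl, ipZr) (ipC W X); ring.
rewrite frob_sqr /K => h; rewrite -(ler_pM2l s20).
move: h b2 b4' b1' b3' b5 b6.
move: (ip (J X) X) (ip (J X) W) (ip (J W) W) (ip X X) (ip X W) (ip W W) (frob X) => i j k xx xw ww x. lra.
Qed.

(** * Linearization of the projected gradient step *)

Let B D := g (P + D) - G.
Let U D := ProjT (P + D) (g (P + D)).

(* The part of [ProjT (P + D) A - ProjT P A] that is linear in [D]. *)
Let dlt D A := D *m A + A *m D - 2 *: (P *m A *m D) - 2 *: (D *m A *m P).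

(** The quadratic remainder of [U]: since [ProjT (P + D) A = ProjT P A + dlt D A - 2 D A D], taking
    [A = G + B D] leaves these terms once [dlt (ProjT P D) G], which is [Omega] of [ProjT P D], has
    been split off. *)
Let Q D := dlt (D - ProjT P D) G - 2 *: (D *m G *m D) + dlt D (B D) - 2 *: (D *m B D *m D).

Let U_expand D : S D -> U D = OmegaOp P G (ProjT P D) + ProjT P (B D) + Q D.
Proof.
move=> SD; rewrite (tangent_OmegaE PT PP minimizer_critical (tangent_ProjT SD)).
rewrite -[LHS]subr0 -minimizer_critical /U -[g (P + D)](subrK G) -/(B D).
rewrite /Q /dlt; move: (ProjT P D) => X; move: (B D) G => B0 G0.
rewrite !ProjTE; mx_expand; mx_close.
Qed.

Let resid_lino : lino S (fun D => B D - H D).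
Proof. by move=> e /g_frechet[d d_0 Hd]; exists d => // D _; exact: Hd. Qed.

Let powO_B : powO S 1 B.
Proof.
apply: powO_ext; first by move=> D _; rewrite -(subrK (H D) (B D)).
by apply: powOD; [exact: lino_powO|exact: powO_lin (powO_id _)].
Qed.

Let powO_dlt k l f h : powO S k f -> powO S l h -> powO S (k + l) (fun D => dlt (f D) (h D)).
Proof.
move=> Hf Hh; have c X : powO S 0 (fun=> X) by exact: powO_cst.
apply: powOB; last by apply: powOZ; rewrite -[(k + l)%N]addn0; apply: powOM (c _); exact: powOM.
apply: powOB; first by apply: powOD; [exact: powOM|rewrite addnC; exact: powOM].
by apply: powOZ; rewrite addnC; apply: powOM => //; exact: (powOM (k := 0) (c _) Hh).
Qed.

Let powO_Q : powO S 2 Q.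
Proof.
have c X : powO S 0 (fun=> X) by exact: powO_cst.
apply: powOB.
  apply: powOD; last exact: (powO_dlt (powO_id _) powO_B).
  apply: powOB; first exact: (powO_dlt (k := 2) (l := 0) powO_defect (c _)).
  apply: powOZ; exact: (powOM (powOM (powO_id _) (c _)) (powO_id _)).
apply: powOZ; apply: powOS; exact: (powOM (powOM (powO_id _) powO_B) (powO_id _)).
Qed.

Let powO_U : powO S 1 U.
Proof.
apply: powO_ext; first by move=> D SD; rewrite U_expand.
apply: powOD; last exact/powOS/powO_Q.
apply: powOD; last by apply: (powO_lin (A := ProjT P)) powO_B; [exact: ProjTD|exact: ProjTZ].
by apply: (powO_lin (A := OmegaOp P G)) powO_ProjT; [exact: OmegaD|exact: OmegaZ].
Qed.

Lemma projected_gradient_expand : lino S (fun D => ProjT P (U D) - J (ProjT P D)).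
Proof.
(* [Omega] of a tangent matrix is fixed by the projection, so it cancels; what is left is an [o(D)]
   and two terms of second order. *)
have E D : S D -> ProjT P ((B D - H D) + H (D - ProjT P D) + Q D) = ProjT P (U D) - J (ProjT P D).
  move=> SD; have /(tangentP PT PP)[_ OP] := tangent_Omega PT PP (gT P) (tangent_ProjT SD).
  have HB : H (D - ProjT P D) = H D - H (ProjT P D) by rewrite -scaleN1r HD HZ scaleN1r.
  rewrite U_expand // /riem_hess HB (ProjT_idem PP D).
  rewrite !(ProjTD P _ (Q D)) (ProjTD P (OmegaOp _ _ _)) OP (ProjT_idem PP (B D)).
  rewrite (ProjTD P (B D - H D)) (ProjTB P (B D)) (ProjTB P (H D)).
  move: (OmegaOp _ _ _) (ProjT P (H _)) (ProjT P (H D)) (ProjT P (B D)) (ProjT P (Q D)) => *; mx_close.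
apply: (lino_ext E); apply: (lino_lin (A := ProjT P)); [exact: ProjTD|exact: ProjTZ|].
apply: linoD; last exact/powO_lino/powO_Q.
by apply: linoD => //; apply/powO_lino; exact: powO_lin powO_defect.
Qed.

(** The argument of the retraction is regarded as [P] plus the displacement [Y = D - beta U], of
    order [D], rather than as a step from the moving point [P + D]. Its error is then [O(D ^ 2)]
    with constants attached to [P] alone, without any uniformity in the base point. *)
Lemma step_expand (beta e : R) : 0 < e -> exists2 d, 0 < d & forall D, S D -> frob D < d ->
  let P1 := Rt (P + D - beta *: ProjT (P + D) (g (P + D))) in
  MN N P1 /\ frob (P1 - P - (ProjT P D - beta *: J (ProjT P D))) <= e * frob D.
Proof.
move=> e0; have e20 : 0 < e / 2 by rewrite divr_gt0.
have YO : powO S 1 (fun D => D - beta *: U D).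
  by apply: powOB; [exact: powO_id|apply: powOZ; exact: powO_U].
have [C C_0 [d1 d10 H1]] := YO.
have [d2 d20 H2] := linoZ (- beta) projected_gradient_expand e20.
(* As [|Y| <= C |D|], the third bound keeps [Y] in the range of the retraction estimate and the
   fourth gives [C0 |Y| ^ 2 <= (e / 2) |D|]. *)
pose d := Num.min (Num.min d1 d2) (Num.min (d0 / C) (e / 2 / (C0 * C ^+ 2))).
have CC : 0 < C0 * C ^+ 2 by rewrite mulr_gt0 ?exprn_gt0.
exists d; first by rewrite !lt_min d10 d20 !divr_gt0.
move=> D SD; rewrite !lt_min => /andP[/andP[D1 D2] /andP[]]; rewrite !ltr_pdivlMr // => D3 D4.
have {}H1 := H1 D SD D1; rewrite expr1 in H1.
set Y := D - beta *: U D in H1.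
have YT : Y^T = Y.
  rewrite /Y linearB /= linearZ /= (feasible_sym SD) /U trmx_ProjT ?gT //.
  by case: SD.
have [|M1 M2] := Rt_expand YT; first by apply: le_lt_trans H1 _; rewrite mulrC.
have EY : P + D - beta *: ProjT (P + D) (g (P + D)) = P + Y by rewrite /Y /U addrA.
rewrite EY; split=> //.
have -> : Rt (P + Y) - P - (ProjT P D - beta *: J (ProjT P D)) =
   (Rt (P + Y) - P - ProjT P Y) + - beta *: (ProjT P (U D) - J (ProjT P D)).
  have -> : ProjT P Y = ProjT P D - beta *: ProjT P (U D) by rewrite /Y ProjTB ProjTZ.
  by move: (J (ProjT P D)) (ProjT P D) (ProjT P (U D)) (Rt (P + Y)) => *; mx_close.
apply: le_trans (frobD _ _) _; rewrite (splitr e) mulrDl; apply: lerD; last exact: H2.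
apply: le_trans M2 _; apply: (@le_trans _ _ (C0 * (C * frob D) ^+ 2)).
  by rewrite ler_pM2l // ler_pXn2r ?nnegrE ?mulr_ge0 ?frob_ge0 // ltW.
have -> : C0 * (C * frob D) ^+ 2 = frob D * (C0 * C ^+ 2) * frob D by ring.
by apply: ler_wpM2r; [exact: frob_ge0|move: D4; move: (frob D) => x; lra].
Qed.

Lemma gradient_descent_rate : exists2 beta0, 0 < beta0 &
  forall beta, 0 < beta -> beta < beta0 ->
    let r := specrad (tangent P) (fun X => X - beta *: J X) in
    r < 1 /\ exists2 delta, 0 < delta & forall theta, 0 < theta -> exists2 C, 0 < C &
      forall P0, MN N P0 -> frob (P0 - P) < delta -> forall k,
        frob (iter k (fun Q => Rt (Q - beta *: ProjT Q (g Q))) P0 - P)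
          <= C * (r + theta) ^+ k * frob (P0 - P).
Proof.
have [M M0 HMJ] := linear_mx_bounded riem_hessD riem_hessZ.
(* An eigenvalue of [1 - beta J] on the tangent space is [1 - beta j] with [eta <= j <= M];
   [beta < 1 / M] puts it strictly between [0] and [1]. *)
exists M^-1; first by rewrite invr_gt0.
move=> beta b0 bM r.
have {}bM : beta * M < 1 by rewrite -ltr_pdivlMr // mul1r.
have LD X Y : X + Y - beta *: J (X + Y) = (X - beta *: J X) + (Y - beta *: J Y).
  by rewrite riem_hessD; move: (J X) (J Y) => *; mx_close.
have LZ a X : a *: X - beta *: J (a *: X) = a *: (X - beta *: J X).
  by rewrite riem_hessZ; move: (J X) => *; mx_close.
(* Tangent matrices are symmetric, so the projection from the space of all matrices must symmetrize
   as well. *)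
have prT X : tangent P (ProjT P (symz X)).
  by apply/(tangentP PT PP); rewrite trmx_ProjT // trmx_symz ProjT_idem.
have TP X : tangent P X <-> ProjT P (symz X) = X.
  split=> [/(tangentP PT PP)[XT XP]|<-]; last exact: prT.
  by rewrite symz_id.
have tanB X Y : tangent P X -> tangent P Y -> tangent P (X - beta *: Y).
  move=> /(tangentP PT PP)[XT XP] /(tangentP PT PP)[YT YP]; apply/(tangentP PT PP).
  by rewrite linearB /= linearZ /= XT YT ProjTB ProjTZ XP YP.
have [Hr Hl] := @specrad_selfadjoint R n (tangent P) (fun X => ProjT P (symz X))
  (fun X => X - beta *: J X) LD LZ
  (fun X Y => etrans (congr1 (ProjT P) (symzD X Y)) (ProjTD P (symz X) (symz Y)))
  (fun a X => etrans (congr1 (ProjT P) (symzZ a X)) (ProjTZ P a (symz X)))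
  (fun X Y => etrans (ip_ProjT PT (symz X) Y) (etrans (ip_symz X (ProjT P Y))
     (congr1 (ip X) (esym (ProjT_symz Y PT)))))
  TP prT (fun X tX => tanB _ _ tX (tangent_riem_hess tX))
  (fun X Y _ _ => etrans (ipBl _ _ _) (etrans (congr2 (fun x y => x - y) (erefl _)
     (etrans (ipZl _ _ _) (etrans (congr1 ( *%R beta) (riem_hess_selfadjoint X Y)) (esym (ipZr _ _ _)))))
     (esym (ipBr _ _ _)))).
rewrite -/r in Hr Hl.
have r0 : 0 <= r by case: Hl => [->//|[l [X [_ _ <- _]]]]; exact: normr_ge0.
have r1 : r < 1.
  case: Hl => [->//|[l [X [tX X0 <- LX]]]].
  have Xp : 0 < ip X X.
    rewrite -frob_sqr exprn_gt0 // lt_def frob_ge0 andbT.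
    by apply: contra X0 => /eqP/frob_eq0/eqP.
  have Jup : ip (J X) X <= M * ip X X.
    rewrite -frob_sqr expr2 mulrA; apply: le_trans (ler_norm _) _.
    by apply: le_trans (ip_cauchy_schwarz _ _) _; rewrite ler_wpM2r ?frob_ge0.
  have Jlo : eta * ip X X <= ip (J X) X by rewrite -frob_sqr; exact: riem_hess_coercive.
  have El : l * ip X X = ip X X - beta * ip (J X) X by rewrite -ipZl -LX ipBl ipZl.
  have B1 : beta * ip (J X) X <= beta * (M * ip X X) by rewrite ler_pM2l.
  have B2 : beta * (eta * ip X X) <= beta * ip (J X) X by rewrite ler_pM2l.
  have B3 : 0 < beta * eta * ip X X by rewrite !mulr_gt0.
  have B4 : beta * M * ip X X < 1 * ip X X by rewrite ltr_pM2r.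
  rewrite ltr_norml; apply/andP; split; rewrite -(ltr_pM2r Xp) El;
    move: B1 B2 B3 B4 Xp; move: (ip (J X) X) (ip X X) => *; lra.
split=> //.
apply: (@linear_rate R _ (MN N) (fun Q => Rt (Q - beta *: ProjT Q (g Q))) (fun Q => frob (Q - P)) r) => //.
  by move=> ?; exact: frob_ge0.
move=> e e0; have [d d_0 Hd] := step_expand beta e0.
exists d => // P' MP' Pd; set D := P' - P in Pd *.
have EP : P' = P + D by rewrite /D addrC subrK.
have SD : S D by rewrite -EP.
have [M1 M2] := Hd D SD Pd; rewrite -EP in M1 M2; split=> //.
set W := ProjT P D - beta *: J (ProjT P D) in M2.
rewrite -(subrK W (_ - P)) mulrDl addrC; apply: le_trans (frobD _ _) (lerD _ M2).
apply: le_trans (Hr _ (tangent_ProjT SD)) _; apply: ler_wpM2l => //.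
exact: frob_ProjT.
Qed.

End LocalAnalysis.

Lemma symz_MN (R : realType) n N (E : 'M[R]_n -> R) Q : MN N Q -> (E \o symz) Q = E Q.
Proof. by case=> QT _; rewrite /= symz_id. Qed.

Theorem theorem3p2 (R : realType) (Nb N : nat)
  (E : 'M[R]_Nb -> R) (Rt : 'M[R]_Nb -> 'M[R]_Nb) (Ps : 'M[R]_Nb) :
  (1 <= N)%N -> (N <= Nb)%N ->
  C2 (E \o symz) ->
  MN N Ps ->
  (exists eta : R, 0 < eta /\ exists rho : R, 0 < rho /\
     forall P, MN N P -> frob (P - Ps) < rho ->
       E Ps + eta * frob (P - Ps) ^+ 2 <= E P) ->
  C2 (Rt \o symz) ->
  (forall A : 'M[R]_Nb, A^T = A -> (Rt A)^T = Rt A) ->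
  (forall P, MN N P -> exists d : R, 0 < d /\ exists C : R, 0 < C /\
     forall X : 'M[R]_Nb, X^T = X -> frob X < d ->
       MN N (Rt (P + X)) /\
       frob (Rt (P + X) - P - ProjT P X) <= C * frob X ^+ 2) ->
  exists beta0 : R, 0 < beta0 /\
    forall beta : R, 0 < beta -> beta < beta0 ->
      let r := specrad (tangent Ps) (fun X => X - beta *: Jgrad E Ps X) in
      r < 1 /\
      exists delta : R, 0 < delta /\
        forall theta : R, 0 < theta ->
          exists C : R, 0 < C /\
            forall P0, MN N P0 -> frob (P0 - Ps) < delta ->
              forall k : nat,
                frob (gd_iter E Rt beta P0 k - Ps)
                  <= C * (r + theta) ^+ k * frob (P0 - Ps).
Proof.
move=> _ _ EC2 MP [eta [eta0 [rho [rho0 Pmin]]]] _ _ Ret.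
have [dF [ddF cddF]] := EC2.
have FT Q u : (E \o symz) (u^T + Q) = (E \o symz) (u + Q) by rewrite /= !symzD symz_tr.
pose H := hess (E \o symz) Ps.
have gT := trmx_grad FT.
have HT := trmx_hess FT Ps.
have HD := hessD ddF cddF Ps.
have HZ := hessZ ddF Ps.
have H_sa := hess_selfadjoint FT dF ddF cddF Ps.
have g_fr := fun e => @grad_frechet _ _ _ ddF cddF Ps e.
have F_ty := fun e => @C2_taylor2 _ _ _ FT dF ddF cddF Ps e.
have Pmin' Q : MN N Q -> frob (Q - Ps) < rho ->
    (E \o symz) Ps + eta * frob (Q - Ps) ^+ 2 <= (E \o symz) Q.
  by move=> MQ; rewrite (symz_MN E MP) (symz_MN E MQ); exact: Pmin.
have [d0 [d00 [C0 [C00 Ret0]]]] := Ret Ps MP.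
have [beta0 b00 Hb] := gradient_descent_rate MP gT HT HD HZ H_sa g_fr F_ty eta0 rho0 d00 C00 Pmin' Ret0.
(* The two gradients agree by definition; only the Hessian, a derivative of a matrix-valued map in
   [Jgrad], needs [derive_grad]. *)
have EJ : Jgrad E Ps = riem_hess Ps (grad (E \o symz) Ps) H.
  apply/funext => X.
  exact (congr1 (fun Z => OmegaOp Ps (gradE E Ps) X + ProjT Ps Z) (derive_grad ddF Ps (ProjT Ps X))).
exists beta0; split=> // beta b0 bb.
have [r1 [delta delta0 Hdelta]] := Hb beta b0 bb.
rewrite EJ; split=> //; exists delta; split=> // theta th0.
by have [C C_0 HC] := Hdelta theta th0; exists C; split.
Qed.
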